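(* Suppose that $k\lesssim\frac n{\log p}$ and that $\widehat\beta^L$ is the Lasso estimator defined in the context with $A>\sqrt2$. Let $$\widetilde L_2=\Big(\frac1{n_2}\big\|y^{(2)}-X^{(2)}\widehat\beta^L\big\|_2^2-\sigma_0^2\Big)_+ .$$ Then for any sequence $\delta_{n,p}\to\infty$, $$\limsup_{n,p\to\infty}\ \sup_{\theta\in\Theta_0(k)}\mathbb P_\theta\Big(\big|\widetilde L_2-\|\widehat\beta^L-\beta\|_2^2\big|\ge\delta_{n,p}\frac1{\sqrt n}\Big)=0 .$$
   Context: Model: one observes $Z=(X,y)$ with $y=X\beta+\epsilon$, $X\in\mathbb R^{n\times p}$ with i.i.d. rows $X_{i\cdot}\sim N_p(0,\Sigma)$, $\epsilon\sim N_n(0,\sigma^2\mathrm I)$ independent of $X$. The parameter is $\theta=(\beta,\Sigma,\sigma)$; $\mathbb P_\theta$ is probability under $\theta$, and $\beta$ in the display is the first component of $\theta$. $\Theta_0(k)=\{(\beta,\mathrm I,\sigma_0):\|\beta\|_0\le k\}$, where $\sigma_0>0$ is the known noise level and $\|\beta\|_0$ is the number of nonzero coordinates. $a_+=\max\{a,0\}$. For positive sequences, $a_n\lesssim b_n$ means $a_n\le Cb_n$ for all $n$, with $C$ a generic positive constant, and $a_n\asymp b_n$ means $a_n\lesssim b_n$ and $b_n\lesssim a_n$. Lasso: $Z$ is randomly split into subsamples $Z^{(1)}=(y^{(1)},X^{(1)})$ and $Z^{(2)}=(y^{(2)},X^{(2)})$ of sizes $n_1$ and $n_2$ with $n_1\asymp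 n_2$, and $$\widehat\beta^L=\arg\min_{\beta\in\mathbb R^p}\frac{\|y^{(1)}-X^{(1)}\beta\|_2^2}{n_1}+\lambda\sum_{j=1}^p\frac{\|X^{(1)}_{\cdot j}\|_2}{\sqrt{n_1}}|\beta_j|,\qquad \lambda=A\sqrt{\tfrac{\log p}{n_1}}\,\sigma_0,$$ where $X^{(1)}_{\cdot j}$ is the $j$-th column of $X^{(1)}$ and $A$ is a pre-specified constant.
   Formalization: The condition k ≲ n/log p is taken as k ≤ c·n/log p with a sufficiently small constant c > 0 depending only on the constant in n_1 ≍ n_2; for arbitrarily large constants the claim fails (e.g. p = n², k = 10n/log p). *)

(* Defs.v *)
From HB Require Import structures.
From mathcomp Require Import all_boot all_order all_algebra.
From mathcomp Require Import all_classical all_reals all_analysis.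

Set Implicit Arguments.
Unset Strict Implicit.
Unset Printing Implicit Defensive.

Import Order.TTheory GRing.Theory Num.Theory.
Import numFieldNormedType.Exports.

Local Open Scope classical_set_scope.
Local Open Scope ring_scope.

(** Matrices carry the product sigma-algebra, i.e. the one generated by the
    entries.  It coincides with the Borel sigma-algebra of R^(m x n). *)
Definition mx_display : measure_display -> measure_display.
Proof. exact. Qed.

Definition mx_cylinders d (T : measurableType d) m n : set (set 'M[T]_(m, n)) :=
  [set C | exists i j (B : set T),
     measurable B /\ C = (fun M : 'M[T]_(m, n) => M i j) @^-1` B].

Section mx_measurable.
Context d (T : measurableType d) (m n : nat).

Let mx_set0 : <<s @mx_cylinders d T m n >> set0.
Proof. exact: sigma_algebra0. Qed.

Let mx_setC A : <<s @mx_cylinders d T m n >> A ->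
  <<s @mx_cylinders d T m n >> (~` A).
Proof. exact: sigma_algebraC. Qed.

Let mx_bigcup (F : (set 'M[T]_(m, n))^nat) :
  (forall i, <<s @mx_cylinders d T m n >> (F i)) ->
  <<s @mx_cylinders d T m n >> (\bigcup_i (F i)).
Proof. exact: sigma_algebra_bigcup. Qed.

HB.instance Definition _ := @isMeasurable.Build (mx_display d)
  'M[T]_(m, n) <<s @mx_cylinders d T m n >> mx_set0 mx_setC mx_bigcup.

End mx_measurable.

(** The norm [`|v|] of the library on matrices is the sup norm, hence the
    following. *)
Definition sqnorm2 (R : realType) n (v : 'cV[R]_n) : R :=
  \sum_(i < n) v i ord0 ^+ 2.

Definition norm2 (R : realType) n (v : 'cV[R]_n) : R := Num.sqrt (sqnorm2 v).

Definition norm0 (R : realType) n (v : 'cV[R]_n) : nat :=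
  #|[pred j : 'I_n | v j ord0 != 0]|.

Definition posdef (R : realType) p (S : 'M[R]_p) : Prop :=
  S^T = S /\
  forall u : 'cV[R]_p, u != 0 -> 0 < (u^T *m S *m u) ord0 ord0.

Definition possemidef (R : realType) p (S : 'M[R]_p) : Prop :=
  S^T = S /\ forall u : 'cV[R]_p, 0 <= (u^T *m S *m u) ord0 ord0.

(** The law on R^p of a vector of i.i.d. N(0, 1) coordinates: its value on the
    rectangles determines it. *)
Definition std_gaussian (R : realType) p (g : probability 'cV[R]_p R) : Prop :=
  forall A : 'I_p -> set R, (forall j, measurable (A j)) ->
    (g [set v : 'cV[R]_p | forall j, A j (v j ord0)] =
     \prod_(j < p) normal_prob (0 : R) (1 : R) (A j))%E.

(** [nu] is N_p(mu, Sigma), the law of [mu + Sigma^(1/2) g] for [g] standard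
    Gaussian and [Sigma^(1/2)] the positive semidefinite square root. *)
Definition gaussian_law (R : realType) p (nu : set 'cV[R]_p -> \bar R)
    (mu : 'cV[R]_p) (Sigma : 'M[R]_p) : Prop :=
  exists (g : probability 'cV[R]_p R) (S : 'M[R]_p),
    [/\ std_gaussian g, possemidef S, S *m S = Sigma &
        forall A, measurable A -> nu A = g [set v | A (mu + S *m v)]].

Record param (R : realType) (p : nat) := Param {
  pbeta : 'cV[R]_p ;
  pSigma : 'M[R]_p ;
  psigma : R }.

Definition admissible (R : realType) p (theta : param R p) : Prop :=
  posdef (pSigma theta) /\ 0 < psigma theta.

Definition Theta0 (R : realType) p (sigma0 : R) (k : nat) : set (param R p) :=
  [set theta | [/\ (norm0 (pbeta theta) <= k)%N,
                   pSigma theta = 1%:M & psigma theta = sigma0]].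

(** Under [P], [y = X beta + eps], where the rows of [X] are i.i.d.
    N_p(0, Sigma) and [eps ~ N_n(0, sigma^2 I)] is independent of [X]. *)
Definition linear_model (R : realType) d (Om : measurableType d) n p
    (P : probability Om R) (X : {mfun Om >-> 'M[R]_(n, p)})
    (y : {mfun Om >-> 'cV[R]_n}) (theta : param R p) : Prop :=
  let Xrow i w : 'cV[R]_p := (row i (X w))^T in
  let eps w : 'cV[R]_n := y w - X w *m pbeta theta in
  [/\ forall A : 'I_n -> set 'cV[R]_p, (forall i, measurable (A i)) ->
        (P [set w | forall i, A i (Xrow i w)] =
         \prod_(i < n) P [set w | A i (Xrow i w)])%E,
      forall i, gaussian_law (fun A => P (Xrow i @^-1` A)) 0 (pSigma theta),
      gaussian_law (fun B => P (eps @^-1` B)) 0 ((psigma theta ^+ 2)%:M) &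
      forall (A : set 'M[R]_(n, p)) (B : set 'cV[R]_n),
        measurable A -> measurable B ->
        (P (X @^-1` A `&` eps @^-1` B) = P (X @^-1` A) * P (eps @^-1` B))%E].

(** [S], the set of indices of the first subsample, is uniform among the
    subsets of size [n1] and independent of the data [(X, y)]. *)
Definition random_split (R : realType) d (Om : measurableType d) n p
    (P : probability Om R) (X : {mfun Om >-> 'M[R]_(n, p)})
    (y : {mfun Om >-> 'cV[R]_n}) (n1 : nat) (S : Om -> {set 'I_n}) : Prop :=
  (forall I : {set 'I_n}, measurable [set w | S w = I]) /\
  forall I : {set 'I_n}, #|I| = n1 ->
    forall A : set ('M[R]_(n, p) * 'cV[R]_n), measurable A ->
      (P [set w | S w = I /\ A (X w, y w)] =
       ('C(n, n1)%:R^-1)%:E * P [set w | A (X w, y w)])%E.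

Definition subsample (R : realType) n q (I : {set 'I_n}) (M : 'M[R]_(n, q)) :
    'M[R]_(#|I|, q) :=
  rowsub (fun i : 'I_#|I| => enum_val i) M.

Definition lasso_obj (R : realType) m p (lambda : R) (X : 'M[R]_(m, p))
    (y : 'cV[R]_m) (b : 'cV[R]_p) : R :=
  sqnorm2 (y - X *m b) / m%:R +
  lambda * \sum_(j < p) norm2 (col j X) / Num.sqrt m%:R * `|b j ord0|.

Definition lasso_lambda (R : realType) (A sigma0 : R) (m p : nat) : R :=
  A * Num.sqrt (ln p%:R / m%:R) * sigma0.

(** An estimator is a measurable function of the data.  A minimizer need not be
    unique, so that [bhat] is any measurable selection of minimizers. *)
Definition is_lasso (R : realType) (A sigma0 : R)
    (bhat : forall m p,
       {mfun ('M[R]_(m, p) * 'cV[R]_m)%type >-> 'cV[R]_p}) : Prop :=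
  forall m p (X : 'M[R]_(m, p)) (y : 'cV[R]_m) (b : 'cV[R]_p),
    lasso_obj (lasso_lambda A sigma0 m p) X y (bhat m p (X, y)) <=
    lasso_obj (lasso_lambda A sigma0 m p) X y b.

(** [I] is the first subsample: the residuals are those of the second one,
    [~: I], of size [n2 = n - #|I|]. *)
Definition Ltilde2 (R : realType) n p (sigma0 : R) (I : {set 'I_n})
    (X : 'M[R]_(n, p)) (y : 'cV[R]_n) (b : 'cV[R]_p) : R :=
  Num.max
    (#|~: I|%:R^-1 * sqnorm2 (subsample (~: I) y - subsample (~: I) X *m b)
     - sigma0 ^+ 2) 0.

(* Main.v *)
From HB Require Import structures.
Require Import Defs.
From mathcomp Require Import all_boot all_order all_algebra.
From mathcomp Require Import all_classical all_reals all_analysis.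
From mathcomp Require Import measurable_realfun.
From mathcomp Require Import ring lra.
Import Order.TTheory GRing.Theory Num.Theory.
Import numFieldNormedType.Exports.
Local Open Scope classical_set_scope.
Local Open Scope ring_scope.

(** With [h = bhat - beta], the second-sample residual has independent
    N(0, |h|^2 + sigma^2) coordinates given the first sample, so
    [Ltilde2 - |h|^2] is of order [(|h|^2 + sigma^2) / sqrt n]; it remains to
    bound [|h|] with probability tending to 1.  No domination of the noise by
    the penalty is needed for that (it fails for [A < 2 sqrt 2]): the basic
    inequality only uses that [|eps|^2 / n1] is bounded, and yields
    [|h|_1 <~ sqrt (n / log p) + sqrt k |h|_2].  A lower bound
    [|X h|^2 / n1 >= kappa |h|_2^2 - C (log p / n1) |h|_1^2], uniform in [h],
    then gives [|h|_2 = O(1)].  By Maurey's empirical method this bound only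
    has to be checked on the finitely many signed sums of about [n1 / log p]
    basis vectors, where a chi-square tail bound and a union bound suffice.
    When [log p > 8 n1], sparsity forces [beta = 0] and [bhat = 0]. *)

Set Implicit Arguments.
Unset Strict Implicit.
Unset Printing Implicit Defensive.

(** * Random matrices with independent Gaussian entries *)

(** One object carries all the probability: the matrix formed by the columns of [X] and the noise
    divided by [sigma], with i.i.d. N(0, 1) entries. Column norms, noise norm and (given the first
    sample) the second-sample residual all have the form |M u|^2, so the single moment E exp(t |M
    u|^2) = (1 - 2 t |u|^2)^(-m/2) yields every tail bound. The union bound over signed sums costs
    exp(C m) with C large, more than deviations from the mean by a moderate factor can pay for. A
    small-ball bound can: |M u|^2 <= 2 e^(-a) m |u|^2 has probability at most exp(-(a/2 - 1) m),
    with [a] as large as desired at the price of a tiny kappa. Absorbing the |h|_1^2 term then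
    forces k log p / n1 to be small compared with kappa^2, whence the constant in k <~ n / log p.
    The threshold 8: if log p <= 8 n1, the extra factors p in the union bound cost only exp(O(n1));
    otherwise A^2 log p / n1 > 16, and the penalty outweighs every correlation between the columns
    and a noise with |eps|^2 <= 4 sigma^2 n1. *)

Lemma measurable_mx_entry d (T : measurableType d) m n (i : 'I_m) (j : 'I_n) :
  measurable_fun setT (fun M : 'M[T]_(m, n) => M i j).
Proof.
move=> _ B mB; rewrite setTI; apply: sub_gen_smallest.
by exists i, j, B.
Qed.

Lemma measurable_fun_mx d (T : measurableType d) d' (U : measurableType d') m n
    (f : U -> 'M[T]_(m, n)) :
  (forall i j, measurable_fun setT (fun x => f x i j)) ->
  measurable_fun setT f.
Proof.
move=> mf; apply: (@measurability _ _ _ _ _ _ (@mx_cylinders d T m n)) => //.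
move=> _ [_ [i [j [B [mB ->]]]] <-].
exact: (mf i j measurableT _ mB).
Qed.

Definition mx_box (R : realType) m n (B : 'I_m -> 'I_n -> set R) :
    set 'M[R]_(m, n) := [set M | forall i j, B i j (M i j)].

Definition mx_boxes (R : realType) m n : set (set 'M[R]_(m, n)) :=
  [set C | exists2 B, forall i j, measurable (B i j) & C = mx_box B].

Lemma measurable_forall d (T : measurableType d) (I : finType)
    (A : I -> set T) :
  (forall i, measurable (A i)) -> measurable [set x | forall i, A i x].
Proof.
move=> mA.
have -> : [set x | forall i, A i x] = \bigcap_(i in [set: I]) A i.
  by apply/seteqP; split => [x Ax i _|x Ax i]; apply: Ax.
by apply: fin_bigcap_measurable => [|i _]; [exact: finite_finset|exact: mA].
Qed.

Lemma measurable_exists d (T : measurableType d) (I : finType)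
    (A : I -> set T) :
  (forall i, measurable (A i)) -> measurable [set x | exists i, A i x].
Proof.
move=> mA.
have -> : [set x | exists i, A i x] = \bigcup_(i in [set: I]) A i.
  by apply/seteqP; split => x [i]; exists i.
by apply: fin_bigcup_measurable => [|i _]; [exact: finite_finset|exact: mA].
Qed.

Lemma measurable_mx_box (R : realType) m n (B : 'I_m -> 'I_n -> set R) :
  (forall i j, measurable (B i j)) -> measurable (mx_box B).
Proof.
move=> mB; apply: measurable_forall => i; apply: measurable_forall => j.
by rewrite -[X in measurable X]setTI; exact: measurable_mx_entry.
Qed.

Lemma mx_boxes_setI (R : realType) m n : setI_closed (@mx_boxes R m n).
Proof.
move=> _ _ [B mB ->] [C mC ->]; exists (fun i j => B i j `&` C i j).
  by move=> i j; exact: measurableI.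
apply/seteqP; split => [M [MB MC] i j|M MBC]; first by split.
by split => i j; have [] := MBC i j.
Qed.

(** Cylinders are not stable under intersection, boxes are: they are the pi-system behind the
    uniqueness of measures. *)
Lemma measurable_mx_boxes (R : realType) m n :
  @measurable _ 'M[R]_(m, n) = <<s @mx_boxes R m n >>.
Proof.
apply/seteqP; split.
  apply: smallest_sub; first exact: smallest_sigma_algebra.
  move=> _ [i0 [j0 [B [mB ->]]]]; apply: sub_gen_smallest.
  exists (fun i j => if (i == i0) && (j == j0) then B else setT).
    by move=> i j; case: ifP.
  apply/seteqP; split => [M /= MB i j|M /= /(_ i0 j0)]; last by rewrite !eqxx.
  by case: ifP => // /andP[/eqP -> /eqP ->].
apply: smallest_sub; first exact: sigma_algebra_measurable.
by move=> _ [B mB ->]; exact: measurable_mx_box.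
Qed.

Lemma mx_measure_unique (R : realType) m n
    (mu nu : {measure set 'M[R]_(m, n) -> \bar R}) :
  (mu setT < +oo)%E ->
  (forall B, (forall i j, measurable (B i j)) -> mu (mx_box B) = nu (mx_box B)) ->
  forall A, measurable A -> mu A = nu A.
Proof.
move=> muoo munu A mA.
have mT : mu setT = nu setT.
  have <- : mx_box (fun (_ : 'I_m) (_ : 'I_n) => [set: R]) = setT.
    by apply/seteqP; split.
  exact: munu.
move: mA (mA); rewrite {1}measurable_mx_boxes => + _.
move: A; apply: (dynkin_induction (P := fun A => mu A = nu A)).
- exact: measurable_mx_boxes.
- exact: mx_boxes_setI.
- exact: mT.
- by move=> _ [B mB ->]; exact: munu.
- move=> S mS muS; rewrite -!setTD !measureD ?setTI//= -?mT//.
  by rewrite muS.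
- move=> F mF tF munuF.
  by rewrite !measure_bigcup//=; apply: eq_eseriesr => i _; exact: munuF.
Qed.

Section integral_normal_prob.
Context (R : realType) (m s : R).
Local Notation mu := (@lebesgue_measure R).
Local Open Scope ereal_scope.
Import HBNNSimple.

Let integral_normal_prob_nnsfun (f : {nnsfun (measurableTypeR R) >-> R}) :
  \int[normal_prob m s]_x (f x)%:E =
  \int[mu]_x ((f x)%:E * (normal_pdf m s x)%:E).
Proof.
have mpdf := measurable_normal_pdf m s.
under [LHS]eq_integral do rewrite fimfunE -fsumEFin//.
rewrite [LHS]ge0_integral_fsum//; last 2 first.
- by move=> r; exact/measurable_EFinP/measurableT_comp.
- by move=> n x _; rewrite EFinM nnfun_muleindic_ge0.
under [RHS]eq_integral.
  move=> x _; rewrite fimfunE -fsumEFin// ge0_mule_fsuml; last first.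
    by move=> r; rewrite EFinM nnfun_muleindic_ge0.
  over.
rewrite [RHS]ge0_integral_fsum//; last 2 first.
- move=> r; apply: emeasurable_funM.
    by apply/measurable_EFinP; exact/measurableT_comp.
  exact/measurable_EFinP.
- move=> r x _; rewrite EFinM mule_ge0//; last by rewrite lee_fin normal_pdf_ge0.
  by rewrite nnfun_muleindic_ge0.
apply: eq_fsbigr => r; rewrite inE => -[x0 _ fx0].
have r0 : (0 <= r)%R by rewrite -fx0.
rewrite integralZl_indic_nnsfun//= integral_indic// setIT.
under [RHS]eq_integral do rewrite EFinM -muleA.
rewrite ge0_integralZl//.
- congr (_ * _); rewrite /normal_prob [LHS]integral_mkcond.
  apply: eq_integral => x _; rewrite patchE indicE.
  by case: ifPn => xr; rewrite ?mul1e ?mul0e.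
- by apply: emeasurable_funM; apply/measurable_EFinP.
- by move=> x _; rewrite mule_ge0// lee_fin ?normal_pdf_ge0.
Qed.

(** [normal_prob] integrates its density over sets; simple functions and monotone convergence carry
    this over to nonnegative integrands. *)
Lemma integral_normal_prob (f : measurableTypeR R -> \bar R) :
  measurable_fun setT f -> (forall x, 0 <= f x) ->
  \int[normal_prob m s]_x f x = \int[mu]_x (f x * (normal_pdf m s x)%:E).
Proof.
move=> mf f0.
have mpdf := measurable_normal_pdf m s.
pose f_ := nnsfun_approx measurableT mf.
transitivity (lim (\int[normal_prob m s]_x (f_ n x)%:E @[n --> \oo])).
  rewrite -monotone_convergence//=.
  - apply: eq_integral => ? /[!inE] xD; apply/esym/cvg_lim => //=.
    exact: cvg_nnsfun_approx.
  - by move=> n; exact/measurable_EFinP/measurable_funTS.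
  - by move=> n ? _; rewrite lee_fin.
  - by move=> ? _ ? ? mn; rewrite lee_fin; exact/lefP/nd_nnsfun_approx.
under eq_fun do rewrite integral_normal_prob_nnsfun.
rewrite -monotone_convergence//=.
- apply: eq_integral => x _; apply/cvg_lim => //=.
  by apply: cvgeZr => //; exact: cvg_nnsfun_approx.
- move=> n; apply: emeasurable_funM; first exact/measurable_EFinP/measurable_funTS.
  exact/measurable_EFinP.
- by move=> n x _; rewrite mule_ge0// lee_fin// normal_pdf_ge0.
- move=> x _ n k nk; rewrite lee_wpmul2r ?lee_fin ?normal_pdf_ge0//.
  exact/lefP/nd_nnsfun_approx.
Qed.

End integral_normal_prob.

(* Completing the square: up to the factor [v^(-1/2) exp(t b^2 / v)], the
   integrand is the density of N(2tab / v, 1 / v), where [v = 1 - 2 t a^2]. *)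
Lemma integral_expR_sqr_normal (R : realType) (t a b : R) :
  0 < 1 - 2 * t * a ^+ 2 ->
  (\int[normal_prob 0 1]_x (expR (t * (a * x + b) ^+ 2))%:E =
   ((Num.sqrt (1 - 2 * t * a ^+ 2))^-1 *
    expR (t * b ^+ 2 / (1 - 2 * t * a ^+ 2)))%:E)%E.
Proof.
have [v vE] : exists v, v = 1 - 2 * t * a ^+ 2 by eexists.
rewrite -vE => v0.
have mexp : measurable_fun setT (fun x : R => expR (t * (a * x + b) ^+ 2)).
  apply: measurableT_comp => //; apply: measurable_funM => //.
  apply: measurable_funX; apply: measurable_funD => //.
rewrite integral_normal_prob//; last first.
- exact/measurable_EFinP.
have sv0 : 0 < Num.sqrt v by rewrite sqrtr_gt0.
pose c := (Num.sqrt v)^-1 * expR (t * b ^+ 2 / v).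
have c0 : 0 <= c by rewrite mulr_ge0 ?invr_ge0 ?expR_ge0// ltW.
transitivity (\int[lebesgue_measure]_x
    (c%:E * (normal_pdf (2 * t * a * b / v) (Num.sqrt v)^-1 x)%:E))%E.
  apply: eq_integral => x _; rewrite -!EFinM; congr EFin.
  rewrite !normal_pdfE ?oner_eq0 ?gt_eqF ?invr_gt0// /normal_peak /normal_fun.
  rewrite exprVn sqr_sqrtr ?ltW// expr1n mul1r.
  have -> : Num.sqrt (v^-1 * pi *+ 2) = (Num.sqrt v)^-1 * Num.sqrt (pi *+ 2).
    by rewrite -mulrnAr sqrtrM ?invr_ge0 ?ltW// sqrtrV ?ltW.
  rewrite invfM invrK /c.
  rewrite subr0 mulrCA -expRD.
  have -> : t * (a * x + b) ^+ 2 + - x ^+ 2 / 2 = t * b ^+ 2 / v +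
      - (x - 2 * t * a * b / v) ^+ 2 / (v^-1 *+ 2).
    by rewrite -(mulr_natr v^-1) vE; field; rewrite -vE gt_eqF.
  rewrite expRD -[RHS]mulrA [X in _ = _ * X]mulrCA -!mulrA mulKf ?gt_eqF//.

rewrite ge0_integralZl//.
- by rewrite integral_normal_pdf mule1.
- by apply/measurable_EFinP; exact: measurable_normal_pdf.
- by move=> x _; rewrite lee_fin normal_pdf_ge0.
Qed.

Lemma exists_distribution (R : realType) d d' (T : measurableType d)
    (U : measurableType d') (P : probability T R) (phi : T -> U) :
  measurable_fun setT phi ->
  exists Q : probability U R, forall A, measurable A -> Q A = P (phi @^-1` A).
Proof.
move=> mphi.
pose F : {mfun T >-> U} := HB.pack phi (isMeasurableFun.Build _ _ _ _ phi mphi).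
by exists (distribution P F).
Qed.

Lemma ge0_integral_law (R : realType) d d' (T : measurableType d)
    (U : measurableType d') (P : probability T R) (Q : probability U R)
    (phi : T -> U) (f : U -> \bar R) :
  measurable_fun setT phi ->
  (forall A, measurable A -> Q A = P (phi @^-1` A)) ->
  measurable_fun setT f -> (forall x, 0 <= f x)%E ->
  (\int[Q]_x f x = \int[P]_x f (phi x))%E.
Proof.
move=> mphi QP mf f0.
rewrite (@eq_measure_integral _ _ _ _ (pushforward P phi)).
  by rewrite ge0_integral_pushforward.
by move=> A mA _; exact: QP.
Qed.

(** * Construction of Gaussian matrices *)

Definition mx_cons (R : realType) m q (x : 'rV[R]_q * 'M[R]_(m, q)) :
    'M[R]_(m.+1, q) :=
  \matrix_(i, j) if unlift ord0 i is Some k then x.2 k j else x.1 ord0 j.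

Lemma measurable_mx_cons (R : realType) m q :
  measurable_fun setT (@mx_cons R m q).
Proof.
apply: measurable_fun_mx => i j.
under eq_fun do rewrite mxE.
case: (unlift ord0 i) => [k|].
  exact: (measurableT_comp (@measurable_mx_entry _ _ _ _ k j) measurable_snd).
exact: (measurableT_comp (@measurable_mx_entry _ _ _ _ ord0 j) measurable_fst).
Qed.

Lemma row_mx_cons0 (R : realType) m q (x : 'rV[R]_q * 'M[R]_(m, q)) :
  row ord0 (mx_cons x) = x.1.
Proof. by apply/rowP => j; rewrite !mxE unlift_none. Qed.

Lemma row_mx_consS (R : realType) m q (x : 'rV[R]_q * 'M[R]_(m, q)) i :
  row (lift ord0 i) (mx_cons x) = row i x.2.
Proof. by apply/rowP => j; rewrite !mxE liftK. Qed.

Lemma measurable_row (R : realType) m q i :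
  measurable_fun setT (fun M : 'M[R]_(m, q) => row i M).
Proof.
apply: measurable_fun_mx => k j; under eq_fun do rewrite mxE.
exact: measurable_mx_entry.
Qed.

(** Products of nonnegative functions of the rows cover both properties wanted later: indicators
    give the boxes, exponentials the moments of |M u|^2. Tonelli splits off one row at a time. *)
Lemma iid_rows (R : realType) q (gam : probability 'rV[R]_q R) m :
  exists G : probability 'M[R]_(m, q) R,
  forall f : 'I_m -> 'rV[R]_q -> R,
    (forall i, measurable_fun setT (f i)) -> (forall i x, 0 <= f i x) ->
    (\int[G]_M (\prod_(i < m) f i (row i M))%:E =
     \prod_(i < m) \int[gam]_x (f i x)%:E)%E.
Proof.
elim: m => [|m [G GE]].
  exists (\d_(0 : 'M[R]_(0, q))) => f mf f0.
  rewrite big_ord0; under eq_integral do rewrite big_ord0.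
  by rewrite integral_cst//= diracT mule1.
have [G' G'E] := exists_distribution (gam \x G)%E (@measurable_mx_cons R m q).
exists G' => f mf f0.
have mprod (k : nat) (g : 'I_k -> 'rV[R]_q -> R) :
    (forall i, measurable_fun setT (g i)) ->
    measurable_fun setT (fun M : 'M[R]_(k, q) => \prod_(i < k) g i (row i M)).
  move=> mg; apply: measurable_prod => i _.
  exact: (measurableT_comp (mg i) (@measurable_row R k q i)).
rewrite (ge0_integral_law (@measurable_mx_cons R m q) G'E); last 2 first.
- by apply/measurable_EFinP; exact: mprod.
- by move=> M; rewrite lee_fin prodr_ge0.
under eq_integral.
  move=> x _; rewrite big_ord_recl row_mx_cons0.
  under eq_bigr do rewrite row_mx_consS.
  over.
have mS : measurable_fun setT
    (fun M : 'M[R]_(m, q) => \prod_(i < m) f (lift ord0 i) (row i M)).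
  exact: (mprod _ (fun i => f (lift ord0 i))).
rewrite fubini_tonelli1; last 2 first.
- apply/measurable_EFinP; apply: measurable_funM.
    exact: (measurableT_comp (mf ord0) measurable_fst).
  exact: (measurableT_comp mS measurable_snd).
- by move=> x; rewrite lee_fin mulr_ge0// prodr_ge0.
rewrite /fubini_F /= big_ord_recl -(GE (fun i => f (lift ord0 i)))//.
under eq_integral.
  move=> x _; under eq_integral do rewrite EFinM.
  rewrite ge0_integralZl//; last 3 first.
  - exact/measurable_EFinP.
  - by move=> M _; rewrite lee_fin prodr_ge0.
  - by rewrite lee_fin.
  over.
rewrite ge0_integralZr//.
- exact/measurable_EFinP.
- by move=> x _; rewrite lee_fin.
- by apply: integral_ge0 => M _; rewrite lee_fin prodr_ge0.
Qed.

Definition row_cons (R : realType) q (x : R * 'rV[R]_q) : 'rV[R]_q.+1 :=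
  \row_j if unlift ord0 j is Some k then x.2 ord0 k else x.1.

Lemma measurable_row_cons (R : realType) q :
  measurable_fun setT (@row_cons R q).
Proof.
apply: measurable_fun_mx => i j.
under eq_fun do rewrite mxE.
case: (unlift ord0 j) => [k|]; last exact: measurable_fst.
exact: (measurableT_comp (@measurable_mx_entry _ _ _ _ ord0 k) measurable_snd).
Qed.

Lemma row_cons_dot (R : realType) q (x : R * 'rV[R]_q) (u : 'cV[R]_q.+1) :
  (row_cons x *m u) ord0 ord0 = u ord0 ord0 * x.1 +
  (x.2 *m (\col_j u (lift ord0 j) ord0)) ord0 ord0.
Proof.
rewrite !mxE big_ord_recl mxE unlift_none mulrC; congr (_ + _).
by apply: eq_bigr => j _; rewrite !mxE liftK.
Qed.

Lemma measurable_dot (R : realType) q (u : 'cV[R]_q) :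
  measurable_fun setT (fun v : 'rV[R]_q => (v *m u) ord0 ord0).
Proof.
under eq_fun do rewrite mxE.
apply: measurable_sum => j; apply: measurable_funM => //.
exact: measurable_mx_entry.
Qed.

Lemma sqnorm2_ge0 (R : realType) n (v : 'cV[R]_n) : 0 <= sqnorm2 v.
Proof. by apply: sumr_ge0 => i _; rewrite sqr_ge0. Qed.

(* [normal_prob] lives on [measurableTypeR R], whose measure display differs
   from the one of the entries of a matrix. *)
Lemma standard_normal (R : realType) :
  exists N : probability R R,
  [/\ forall B, measurable B -> (N B = normal_prob (0 : R) 1 B)%E &
      forall t a b : R, 0 < 1 - 2 * t * a ^+ 2 ->
      (\int[N]_x (expR (t * (a * x + b) ^+ 2))%:E =
       ((Num.sqrt (1 - 2 * t * a ^+ 2))^-1 *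
        expR (t * b ^+ 2 / (1 - 2 * t * a ^+ 2)))%:E)%E].
Proof.
have mid : measurable_fun setT (id : measurableTypeR R -> R).
  by move=> _ B mB; rewrite setTI.
have [N NE] := exists_distribution (normal_prob (0 : R) 1) mid.
exists N; split => [B mB|t a b tab]; first exact: NE.
rewrite (ge0_integral_law mid NE); first exact: integral_expR_sqr_normal.
- apply/measurable_EFinP; apply: measurableT_comp => //.
  apply: measurable_funM => //; apply: measurable_funX.
  by apply: measurable_funD => //; exact: measurable_funM.
- by move=> x; rewrite lee_fin expR_ge0.
Qed.

(** The shift [b] carries the induction on [q]: integrating out the first coordinate leaves an
    integrand of the same shape in the others, with [t] replaced by [t / v]; the normalizations [v]
    and [w / v] multiply to [w]. *)
Lemma gaussian_row (R : realType) q :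
  exists gam : probability 'rV[R]_q R,
  [/\ forall B : 'I_1 -> 'I_q -> set R, (forall i j, measurable (B i j)) ->
       (gam (mx_box B) = \prod_(j < q) normal_prob (0 : R) 1 (B ord0 j))%E &
      forall (t : R) (u : 'cV[R]_q) (b : R), 0 < 1 - 2 * t * sqnorm2 u ->
       (\int[gam]_v (expR (t * ((v *m u) ord0 ord0 + b) ^+ 2))%:E =
        ((Num.sqrt (1 - 2 * t * sqnorm2 u))^-1 *
         expR (t * b ^+ 2 / (1 - 2 * t * sqnorm2 u)))%:E)%E].
Proof.
have [N [NE NL]] := standard_normal R.
elim: q => [|q [gam [gamB gamL]]].
  exists (\d_(0 : 'rV[R]_0)); split => [B mB|t u b].
    by rewrite big_ord0 /= diracE mem_set// => i [].
  rewrite /sqnorm2 big_ord0 mulr0 subr0 sqrtr1 invr1 mul1r mulr1 => _.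
  under eq_integral.
    move=> v _; rewrite mxE big_ord0 add0r; over.
  by rewrite integral_cst//= diracT mule1.
have [gam' gam'E] := exists_distribution
  (N \x gam)%E (@measurable_row_cons R q).
exists gam'; split => [B mB|t u b].
  rewrite gam'E; last exact: measurable_mx_box.
  have -> : @row_cons R q @^-1` mx_box B =
      B ord0 ord0 `*` mx_box (fun i (j : 'I_q) => B i (lift ord0 j)).
    apply/seteqP; split => [x /= Bx|x /= [B0 BS] i j].
      split; first by have := Bx ord0 ord0; rewrite mxE unlift_none.
      by move=> i j; have := Bx i (lift ord0 j); rewrite mxE liftK ord1.
    rewrite mxE ord1; case: (unliftP ord0 j) => [k ->|->] //.
  have mS : measurable (mx_box (fun i (j : 'I_q) => B i (lift ord0 j))).
    exact: measurable_mx_box.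
  rewrite /= product_measure1E// big_ord_recl -NE//; congr (_ * _)%E.
  exact: (gamB (fun i j => B i (lift ord0 j))).
pose a := u ord0 ord0; pose u' : 'cV[R]_q := \col_j u (lift ord0 j) ord0.
have -> : sqnorm2 u = a ^+ 2 + sqnorm2 u'.
  rewrite /sqnorm2 big_ord_recl; congr (_ + _).
  by apply: eq_bigr => i _; rewrite mxE.
pose v := 1 - 2 * t * a ^+ 2; pose w := 1 - 2 * t * (a ^+ 2 + sqnorm2 u').
rewrite -/w => w0.
have wE : w = v - 2 * t * sqnorm2 u' by rewrite /w /v; ring.
(* If t >= 0 then v >= w > 0; if t < 0 then v >= 1. *)
have v0 : 0 < v.
  have := sqnorm2_ge0 u'; have := sqr_ge0 a; rewrite /v; move: w0; rewrite /w.
  by have [t0|t0] := leP 0 t; nra.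
have mdot c : measurable_fun setT
    (fun v : 'rV[R]_q => expR (c * ((v *m u') ord0 ord0 + b) ^+ 2)).
  apply: measurableT_comp => //; apply: measurable_funM => //.
  by apply: measurable_funX; apply: measurable_funD => //; exact: measurable_dot.
rewrite (ge0_integral_law (@measurable_row_cons R q) gam'E); last 2 first.
- apply/measurable_EFinP; apply: measurableT_comp => //.
  apply: measurable_funM => //; apply: measurable_funX.
  by apply: measurable_funD => //; exact: measurable_dot.
- by move=> x; rewrite lee_fin expR_ge0.
under eq_integral do rewrite row_cons_dot -/a -/u' -addrA.
rewrite fubini_tonelli2; last 2 first.
- apply/measurable_EFinP; apply: measurableT_comp => //.
  apply: measurable_funM => //; apply: measurable_funX.
  apply: measurable_funD; first exact: measurable_funM.
  apply: measurable_funD => //.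
  exact: (measurableT_comp (@measurable_dot R q u') measurable_snd).
- by move=> x; rewrite lee_fin expR_ge0.
rewrite /fubini_G /=.
under eq_integral.
  move=> y _; rewrite NL// -/v EFinM [t * _ / v]mulrAC; over.
rewrite ge0_integralZl//; last by apply/measurable_EFinP; exact: mdot.
have wv : 1 - 2 * (t / v) * sqnorm2 u' = w / v.
  by rewrite wE; field; rewrite gt_eqF.
rewrite gamL wv ?divr_gt0// -EFinM mulrA; congr (_ * expR _)%:E.
  by rewrite -invfM -sqrtrM ?ltW// mulrC divfK ?gt_eqF.
by field; rewrite !gt_eqF.
Qed.

Lemma mx_mul_dot (R : realType) m q (M : 'M[R]_(m, q)) (u : 'cV[R]_q) i :
  (M *m u) i ord0 = (row i M *m u) ord0 ord0.
Proof. by rewrite !mxE; apply: eq_bigr => j _; rewrite mxE. Qed.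

(* The first clause determines [G], hence implies the second one. *)
Definition gaussian_entries (R : realType) m q
    (G : probability 'M[R]_(m, q) R) : Prop :=
  [/\ forall B : 'I_m -> 'I_q -> set R, (forall i j, measurable (B i j)) ->
       (G (mx_box B) =
        \prod_(i < m) \prod_(j < q) normal_prob (0 : R) 1 (B i j))%E &
      forall (t : R) (u : 'cV[R]_q), 0 < 1 - 2 * t * sqnorm2 u ->
       (\int[G]_M (expR (t * sqnorm2 (M *m u)))%:E =
        ((Num.sqrt (1 - 2 * t * sqnorm2 u))^-1 ^+ m)%:E)%E].

Lemma gaussian_mx (R : realType) m q :
  exists G : probability 'M[R]_(m, q) R, gaussian_entries G.
Proof.
have [gam [gamB gamL]] := gaussian_row R q.
have [G GE] := iid_rows gam m.
exists G; split => [B mB|t u tu].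
  pose C i : set 'rV[R]_q := mx_box (fun _ j => B i j).
  have mC i : measurable (C i) by exact: measurable_mx_box.
  transitivity (\int[G]_M (\prod_(i < m) \1_(C i) (row i M))%:E)%E.
    transitivity (\int[G]_M (\1_(mx_box B) M)%:E)%E.
      by rewrite integral_indic ?setIT//; exact: measurable_mx_box.
    apply: eq_integral => M _; congr EFin.
    have [BM|BM] := pselect (mx_box B M).
      rewrite indicE mem_set// big1// => i _; rewrite indicE mem_set// => k j.
      by rewrite mxE.
    have [i nBi] : exists i, ~ C i (row i M).
      apply/existsNP => CM; apply: BM => i j.
      by have := CM i ord0 j; rewrite mxE.
    by rewrite indicE memNset// (bigD1 i)//= indicE memNset// mul0r.
  rewrite (GE (fun i => \1_(C i)))//; apply: eq_bigr => i _.
  by rewrite integral_indic// setIT; exact: gamB.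
under eq_integral.
  move=> M _; rewrite /sqnorm2 mulr_sumr expR_sum.
  under eq_bigr do rewrite mx_mul_dot.
  over.
rewrite (GE (fun _ v => expR (t * ((v *m u) ord0 ord0) ^+ 2))).
- have := gamL t u 0 tu; rewrite expr0n mulr0 mul0r expR0 mulr1.
  under eq_integral do rewrite addr0.
  by move=> ->; rewrite prodEFin prodr_const card_ord.
- move=> i; apply: measurableT_comp => //; apply: measurable_funM => //.
  by apply: measurable_funX; exact: measurable_dot.
- by move=> i v; rewrite expR_ge0.
Qed.

Lemma measurable_fun_sqnorm2 d (T : measurableType d) (R : realType) n
    (f : T -> 'cV[R]_n) :
  (forall i, measurable_fun setT (fun x => f x i ord0)) ->
  measurable_fun setT (fun x => sqnorm2 (f x)).
Proof.
by move=> mf; apply: measurable_sum => i; apply: measurable_funX.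
Qed.

Lemma measurable_fun_mulmx d (T : measurableType d) (R : realType) m n p
    (A : T -> 'M[R]_(m, n)) (B : T -> 'M[R]_(n, p)) i k :
  (forall i j, measurable_fun setT (fun x => A x i j)) ->
  (forall i j, measurable_fun setT (fun x => B x i j)) ->
  measurable_fun setT (fun x => (A x *m B x) i k).
Proof.
move=> mA mB; under eq_fun do rewrite mxE.
by apply: measurable_sum => j; apply: measurable_funM.
Qed.

Lemma measurable_sqnorm2_mul (R : realType) m q (u : 'cV[R]_q) :
  measurable_fun setT (fun M : 'M[R]_(m, q) => sqnorm2 (M *m u)).
Proof.
apply: measurable_fun_sqnorm2 => i; apply: measurable_fun_mulmx => // k j.
exact: measurable_mx_entry.
Qed.

Lemma measurable_ler d (T : measurableType d) (R : realType) (f g : T -> R) :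
  measurable_fun setT f -> measurable_fun setT g ->
  measurable [set x | f x <= g x].
Proof.
move=> mf mg.
by have := measurable_fun_le measurableT mf mg; rewrite setTI.
Qed.

(** * Chi-square tail bounds *)

Lemma markov_expR d (T : measurableType d) (R : realType) (P : probability T R)
    (f : T -> R) (c : R) :
  measurable_fun setT f ->
  (P [set x | (c <= f x)%R] <= (expR (- c))%:E * \int[P]_x (expR (f x))%:E)%E.
Proof.
move=> mf.
have mA : measurable [set x | c <= f x] by exact: measurable_ler.
have mexp : measurable_fun setT (fun x => (expR (f x))%:E).
  by apply/measurable_EFinP; exact: measurableT_comp.
rewrite -[X in (P X <= _)%E]setIT -integral_indic// -ge0_integralZl//.
apply: ge0_le_integral => //.
- exact/measurable_EFinP/measurable_indic.
- exact: emeasurable_funM.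
- move=> x _; rewrite -EFinM lee_fin indicE -expRD.
  have [cf|cf] := boolP (x \in [set x | c <= f x]); last exact: expR_ge0.
  by rewrite -[leLHS]expR0 ler_expR addrC subr_ge0; move: cf; rewrite inE.
Qed.

(** |M u|^2 / |u|^2 is chi-square with [m] degrees of freedom, and [z] bounds its log-moment at [t]
    per row. The sign of [t] is free, so both tails are covered. *)
Lemma gaussian_chernoff (R : realType) m q (G : probability 'M[R]_(m, q) R)
    (u : 'cV[R]_q) (t z c : R) :
  gaussian_entries G -> 0 < sqnorm2 u -> 0 < 1 - 2 * t ->
  (1 - 2 * t)^-1 <= expR (2 * z) ->
  (G [set M | (c <= t / sqnorm2 u * sqnorm2 (M *m u))%R] <=
   (expR (z * m%:R - c))%:E)%E.
Proof.
move=> [_ GL] u0 t0 tz.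
apply: le_trans.
  apply: markov_expR; apply: measurable_funM => //.
  exact: measurable_sqnorm2_mul.
have tE : 1 - 2 * (t / sqnorm2 u) * sqnorm2 u = 1 - 2 * t.
  by field; rewrite gt_eqF.
rewrite GL tE// -EFinM lee_fin expRD mulrC ler_pM2r ?expR_gt0//.
rewrite expRM_natr lerXn2r ?nnegrE ?invr_ge0 ?sqrtr_ge0 ?expR_ge0//.
have -> : expR z = Num.sqrt (expR (2 * z)).
  by rewrite expRM_natl sqrtr_sqr ger0_norm ?expR_ge0.
by rewrite -sqrtrV ?(ltW t0)// ler_wsqrtr.
Qed.

(** Small-ball estimate: with 1 - 2t = e^a the moment is e^(-am/2), while on the event the exponent
    t |M u|^2 / |u|^2 is still at least -m. *)
Lemma gaussian_lower_tail (R : realType) m q (G : probability 'M[R]_(m, q) R)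
    (u : 'cV[R]_q) (a : R) :
  gaussian_entries G -> 0 < sqnorm2 u -> 0 <= a ->
  (G [set M | (sqnorm2 (M *m u) <= 2 * expR (- a) * m%:R * sqnorm2 u)%R] <=
   (expR (- ((a / 2 - 1) * m%:R)))%:E)%E.
Proof.
move=> GG u0 a0.
have e1 : 1 <= expR a by rewrite -expR0 ler_expR.
pose t : R := - ((expR a - 1) / 2).
have tE : 1 - 2 * t = expR a by rewrite /t; field.
apply: (@le_trans _ _ (G [set M | (- m%:R <=
    t / sqnorm2 u * sqnorm2 (M *m u))%R])).
  apply: le_measure; rewrite ?inE.
  - by apply: measurable_ler => //; exact: measurable_sqnorm2_mul.
  - apply: measurable_ler => //; apply: measurable_funM => //.
    exact: measurable_sqnorm2_mul.
  - move=> M /= MW; rewrite /t mulNr mulNr lerN2.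
    rewrite mulrAC ler_pdivrMr//.
    apply: (@le_trans _ _ ((expR a - 1) / 2 *
        (2 * expR (- a) * m%:R * sqnorm2 u))).
      by rewrite ler_wpM2l// divr_ge0// subr_ge0.
    rewrite expRN.
    have -> : (expR a - 1) / 2 * (2 * (expR a)^-1 * m%:R * sqnorm2 u) =
        (1 - (expR a)^-1) * (m%:R * sqnorm2 u).
      by field; rewrite gt_eqF// expR_gt0.
    rewrite ler_piMl//; first by rewrite mulr_ge0// ltW.
apply: (le_trans (@gaussian_chernoff _ _ _ _ _ t (- (a / 2)) _ GG u0 _ _)).
- by rewrite tE expR_gt0.
- by rewrite tE -expRN ler_expR; lra.
- by rewrite lee_fin ler_expR; lra.
Qed.

Lemma gaussian_upper_tail (R : realType) m q (G : probability 'M[R]_(m, q) R)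
    (u : 'cV[R]_q) (D : R) :
  gaussian_entries G -> 0 < sqnorm2 u ->
  (G [set M | (D * m%:R * sqnorm2 u <= sqnorm2 (M *m u))%R] <=
   (expR (- ((D / 4 - 1 / 2) * m%:R)))%:E)%E.
Proof.
move=> GG u0.
have -> : [set M : 'M[R]_(m, q) | D * m%:R * sqnorm2 u <= sqnorm2 (M *m u)] =
    [set M | D * m%:R / 4 <= 4^-1 / sqnorm2 u * sqnorm2 (M *m u)].
  by apply/seteqP; split=> M /=; rewrite [_^-1 / _ * _]mulrAC ler_pdivlMr//; lra.
(* At t = 1/4 the moment per row is sqrt 2 <= exp(1/2). *)
apply: (le_trans (@gaussian_chernoff _ _ _ _ _ 4^-1 (1 / 2) _ GG u0 _ _)).
- lra.
- have -> : (1 - 2 * 4^-1 : R)^-1 = 2 by field.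
  have := expR_ge1Dx (2 * (1 / 2) : R); lra.
- by rewrite lee_fin ler_expR; lra.
Qed.

(** Chernoff at t = 1/sqrt m and t = -1/sqrt m, without optimization: the second-order part of the
    log-moment is then the constant 4, and a tail exp(4 - x) is enough because x will tend to
    infinity. *)
Lemma gaussian_fluctuation (R : realType) m q (G : probability 'M[R]_(m, q) R)
    (u : 'cV[R]_q) (x : R) :
  gaussian_entries G -> 0 < sqnorm2 u -> (16 <= m)%N ->
  (G [set M | (x * sqnorm2 u / Num.sqrt m%:R <=
       `|sqnorm2 (M *m u) / m%:R - sqnorm2 u|)%R] <=
   (2 * expR (4 - x))%:E)%E.
Proof.
move=> GG u0 m16.
have m0 : 0 < m%:R :> R by rewrite ltr0n (leq_trans _ m16).
set r : R := Num.sqrt m%:R.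
have rE : r ^+ 2 = m%:R by rewrite sqr_sqrtr// ltW.
have r4 : 4 <= r.
  have -> : 4 = Num.sqrt (4 ^+ 2) :> R by rewrite sqrtr_sqr ger0_norm.
  by rewrite ler_sqrt// -natrX ler_nat.
have r0 : 0 < r by lra.
pose w := sqnorm2 u; pose tau := r^-1.
have tau0 : 0 < tau by rewrite invr_gt0.
(* Origin of [16 <= m]: for 0 < tau < 1/2, (1 - 2 tau)^-1 <= 1 + 2 tau + 8 tau^2 holds exactly when
   tau <= 1/4. *)
have tau4 : tau <= 4^-1 by rewrite lef_pV2 ?posrE.
have taur : tau * r = 1 by rewrite mulVf ?gt_eqF.
pose A := [set M : 'M[R]_(m, q) |
  tau * m%:R + x <= tau / w * sqnorm2 (M *m u)].
pose B := [set M : 'M[R]_(m, q) |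
  - tau * m%:R + x <= - tau / w * sqnorm2 (M *m u)].
have mW c : measurable_fun setT (fun M : 'M[R]_(m, q) => c * sqnorm2 (M *m u)).
  by apply: measurable_funM => //; exact: measurable_sqnorm2_mul.
have mA : measurable A by exact: measurable_ler.
have mB : measurable B by exact: measurable_ler.
have PA : (G A <= (expR (4 - x))%:E)%E.
  apply: (le_trans (@gaussian_chernoff _ _ _ _ _ tau
      (tau + 4 * tau ^+ 2) _ GG u0 _ _)).
  - lra.
  - have d0 : 0 < 1 - 2 * tau by lra.
    apply: (@le_trans _ _ (1 + (2 * (tau + 4 * tau ^+ 2)))); last exact: expR_ge1Dx.
    rewrite -(mul1r _^-1) ler_pdivrMr//; nra.
  - rewrite lee_fin ler_expR.
    have : tau ^+ 2 * m%:R = 1 by rewrite -rE -exprMn taur expr1n.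
    lra.
have PB : (G B <= (expR (4 - x))%:E)%E.
  apply: (le_trans (@gaussian_chernoff _ _ _ _ _ (- tau)
      (- tau + 4 * tau ^+ 2) _ GG u0 _ _)).
  - lra.
  - have d0 : 0 < 1 - 2 * - tau by lra.
    apply: (@le_trans _ _ (1 + (2 * (- tau + 4 * tau ^+ 2)))); last exact: expR_ge1Dx.
    rewrite -(mul1r _^-1) ler_pdivrMr//; nra.
  - rewrite lee_fin ler_expR.
    have : tau ^+ 2 * m%:R = 1 by rewrite -rE -exprMn taur expr1n.
    lra.
apply: (@le_trans _ _ (G (A `|` B))).
  apply: le_measure; rewrite ?inE.
  - apply: measurable_ler => //; apply: measurableT_comp => //.
    apply: measurable_funB => //; under eq_fun do rewrite mulrC.
    exact: mW.
  - exact: measurableU.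
  move=> M /=; rewrite -/w -/r => H.
  have w0 : 0 < w by [].
  have c0 : 0 < tau * m%:R / w by rewrite divr_gt0// mulr_gt0.
  have E1 : tau * m%:R / w * (x * w / r) = x.
    by rewrite -rE /tau; field; rewrite !gt_eqF.
  have E2 : tau * m%:R / w * (sqnorm2 (M *m u) / m%:R - w) =
      tau / w * sqnorm2 (M *m u) - tau * m%:R.
    by field; rewrite !gt_eqF.
  move: H; rewrite ler_normr => /orP[] /(ler_wpM2l (ltW c0)); rewrite E1.
    by rewrite E2; left; rewrite /A /= -/w; lra.
  by rewrite mulrN E2; right; rewrite /B /= -/w !mulNr; lra.
apply: (le_trans (measureU2 _ mA mB)).
by rewrite mulr2n mulrDl mul1r EFinD leeD.
Qed.

(** * Independence of the two subsamples for a fixed split *)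

Definition split_row n (I : {set 'I_n}) (k : 'I_(#|I| + #|~: I|)) : 'I_n :=
  match fintype.split k with inl i => enum_val i | inr i => enum_val i end.

Lemma split_row_inj n (I : {set 'I_n}) : injective (@split_row n I).
Proof.
move=> k l; rewrite /split_row; case: splitP => i ki; case: splitP => j lj.
- by move=> /enum_val_inj ij; apply/val_inj => /=; rewrite ki lj ij.
- by move=> ij; have := enum_valP i; rewrite ij; have := enum_valP j;
    rewrite inE => /negP.
- by move=> ij; have := enum_valP j; rewrite -ij; have := enum_valP i;
    rewrite inE => /negP.
- by move=> /enum_val_inj ij; apply/val_inj => /=; rewrite ki lj ij.
Qed.

Lemma split_row_bij n (I : {set 'I_n}) : bijective (@split_row n I).
Proof.
by apply: inj_card_bij; [exact: split_row_inj|rewrite !card_ord cardsC card_ord].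
Qed.

Lemma rowsub_split_row (R : realType) n q (I : {set 'I_n}) (M : 'M[R]_(n, q)) :
  rowsub (@split_row n I) M = col_mx (subsample I M) (subsample (~: I) M).
Proof.
apply/matrixP => k j; rewrite !mxE /split_row; case: splitP => i _;
  by rewrite !mxE.
Qed.

(** Both sides are laws of the matrix with its rows listed along [I], then along its complement.
    They need only agree on boxes, whose probability is a product over the entries, hence
    insensitive to the order of the rows. *)
Lemma gaussian_split (R : realType) d (Om : measurableType d)
    (P : probability Om R) n q (Z : Om -> 'M[R]_(n, q)) (I : {set 'I_n})
    (G1 : probability 'M[R]_(#|I|, q) R) (G2 : probability 'M[R]_(#|~: I|, q) R) :
  measurable_fun setT Z ->
  (forall B : 'I_n -> 'I_q -> set R, (forall i j, measurable (B i j)) ->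
    (P [set w | mx_box B (Z w)] =
     \prod_(i < n) \prod_(j < q) normal_prob (0 : R) 1 (B i j))%E) ->
  gaussian_entries G1 -> gaussian_entries G2 ->
  forall W, measurable W ->
  (P [set w | W (subsample I (Z w), subsample (~: I) (Z w))] =
   (G1 \x G2) W)%E.
Proof.
move=> mZ PZ [G1B _] [G2B _] W mW.
have mZs : measurable_fun setT (fun w => rowsub (@split_row n I) (Z w)).
  apply: measurable_fun_mx => k j; under eq_fun do rewrite mxE.
  exact: (measurableT_comp (@measurable_mx_entry _ _ _ _ _ j) mZ).
have mcol : measurable_fun setT
    (fun x : 'M[R]_(#|I|, q) * 'M[R]_(#|~: I|, q) => col_mx x.1 x.2).
  apply: measurable_fun_mx => k j.
  case: (split_ordP k) => i ->; under eq_fun do rewrite ?col_mxEu ?col_mxEd.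
    exact: (measurableT_comp (@measurable_mx_entry _ _ _ _ i j) measurable_fst).
  exact: (measurableT_comp (@measurable_mx_entry _ _ _ _ i j) measurable_snd).
have [Q1 Q1E] := exists_distribution P mZs.
have [Q2 Q2E] := exists_distribution (G1 \x G2)%E mcol.
have Q12 : forall A, measurable A -> Q1 A = Q2 A.
  apply: mx_measure_unique; first by rewrite /= probability_setT ltry.
  move=> B mB; rewrite /= Q1E ?Q2E; [|exact: measurable_mx_box..].
  have [g fK gK] := split_row_bij I.
  have -> : (fun w => rowsub (@split_row n I) (Z w)) @^-1` mx_box B =
      [set w | mx_box (fun i j => B (g i) j) (Z w)].
    apply/seteqP; split => w /= Bw i j.
      by have := Bw (g i) j; rewrite mxE gK.
    by rewrite mxE -{1}(fK i); exact: Bw.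
  rewrite PZ; last by move=> i j.
  have -> : (fun x : 'M[R]_(#|I|, q) * 'M[R]_(#|~: I|, q) => col_mx x.1 x.2)
      @^-1` mx_box B =
      mx_box (fun i j => B (lshift _ i) j) `*`
      mx_box (fun i j => B (rshift _ i) j).
    apply/seteqP; split => [x /= Bx|x /= [Bu Bd] k j].
      split=> i j.
        by have := Bx (lshift _ i) j; rewrite col_mxEu.
      by have := Bx (rshift _ i) j; rewrite col_mxEd.
    by case: (split_ordP k) => i ->; rewrite ?col_mxEu ?col_mxEd.
  rewrite /= product_measure1E; [|exact: measurable_mx_box..].
  rewrite (reindex (@split_row n I)) /=; last by exists g => ? _.
  rewrite big_split_ord /=; congr (_ * _)%E.
    rewrite G1B//; apply: eq_bigr => i _; apply: eq_bigr => j _.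
    by rewrite fK.
  etransitivity; last by apply/esym; exact: G2B.
  by apply: eq_bigr => i _; apply: eq_bigr => j _; rewrite fK.
have mW' : measurable
    [set M : 'M[R]_(#|I| + #|~: I|, q) | W (usubmx M, dsubmx M)].
  rewrite -[X in measurable X]setTI.
  have : measurable_fun setT
      (fun M : 'M[R]_(#|I| + #|~: I|, q) => (usubmx M, dsubmx M)).
    by apply: measurable_fun_pair; apply: measurable_fun_mx => i j;
      under eq_fun do rewrite mxE; exact: measurable_mx_entry.
  by move=> /(_ measurableT _ mW).
have := Q12 _ mW'; rewrite Q1E// Q2E//.
have -> : (fun w => rowsub (@split_row n I) (Z w)) @^-1`
    [set M | W (usubmx M, dsubmx M)] =
    [set w | W (subsample I (Z w), subsample (~: I) (Z w))].
  by apply/seteqP; split => w /=; rewrite rowsub_split_row col_mxKu col_mxKd.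
have -> : (fun x : 'M[R]_(#|I|, q) * 'M[R]_(#|~: I|, q) => col_mx x.1 x.2)
    @^-1` [set M | W (usubmx M, dsubmx M)] = W.
  by apply/seteqP; split => -[x y] /=; rewrite col_mxKu col_mxKd.
by [].
Qed.

(** * Maurey's empirical method and the Lasso inequalities *)

Definition qform (R : realType) p (Q : 'M[R]_p) (u v : 'cV[R]_p) : R :=
  (u^T *m Q *m v) ord0 ord0.

Lemma qformDl (R : realType) p (Q : 'M[R]_p) u u' v :
  qform Q (u + u') v = qform Q u v + qform Q u' v.
Proof. by rewrite /qform linearD /= !mulmxDl mxE. Qed.

Lemma qformDr (R : realType) p (Q : 'M[R]_p) u v v' :
  qform Q u (v + v') = qform Q u v + qform Q u v'.
Proof. by rewrite /qform mulmxDr mxE. Qed.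

Lemma qformZl (R : realType) p (Q : 'M[R]_p) a u v :
  qform Q (a *: u) v = a * qform Q u v.
Proof. by rewrite /qform linearZ /= -!scalemxAl mxE. Qed.

Lemma qformZr (R : realType) p (Q : 'M[R]_p) a u v :
  qform Q u (a *: v) = a * qform Q u v.
Proof. by rewrite /qform -scalemxAr mxE. Qed.

Lemma qform0l (R : realType) p (Q : 'M[R]_p) v : qform Q 0 v = 0.
Proof. by rewrite /qform linear0 !mul0mx mxE. Qed.

Lemma qform0r (R : realType) p (Q : 'M[R]_p) u : qform Q u 0 = 0.
Proof. by rewrite /qform mulmx0 mxE. Qed.

Lemma qform_suml (R : realType) p (Q : 'M[R]_p) I (r : seq I) F v :
  qform Q (\sum_(i <- r) F i) v = \sum_(i <- r) qform Q (F i) v.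
Proof.
elim: r => [|i r IH]; first by rewrite !big_nil qform0l.
by rewrite !big_cons qformDl IH.
Qed.

Lemma qform_sumr (R : realType) p (Q : 'M[R]_p) I (r : seq I) u F :
  qform Q u (\sum_(i <- r) F i) = \sum_(i <- r) qform Q u (F i).
Proof.
elim: r => [|i r IH]; first by rewrite !big_nil qform0r.
by rewrite !big_cons qformDr IH.
Qed.

Definition basis_vec (R : realType) p (j : 'I_p) : 'cV[R]_p := delta_mx j ord0.

Lemma cV_delta (R : realType) p (x : 'cV[R]_p) : x = \sum_j x j ord0 *: (basis_vec R j).
Proof.
rewrite {1}[x]matrix_sum_delta; apply: eq_bigr => j _.
by rewrite big_ord_recl big_ord0 addr0.
Qed.

Lemma qform_delta (R : realType) p (Q : 'M[R]_p) j :
  qform Q (basis_vec R j) (basis_vec R j) = Q j j.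
Proof. by rewrite /qform /basis_vec trmx_delta -rowE -colE !mxE. Qed.

Definition signed_sum (R : realType) p (t : seq ('I_p * bool)) : 'cV[R]_p :=
  \sum_(k <- t) (-1) ^+ k.2 *: basis_vec R k.1.

(* Maurey's empirical method: the right-hand side is the expectation of the
   left-hand side when the indices are drawn independently, [j] with
   probability [|x_j| / L] and with the sign of [x_j]. *)
Lemma maurey (R : realType) p (Q : 'M[R]_p) (x : 'cV[R]_p) :
  let L := \sum_j `|x j ord0| in
  0 < L -> forall s (a : 'cV[R]_p), exists t : s.-tuple ('I_p * bool),
  qform Q (a + signed_sum R t) (a + signed_sum R t) <=
  qform Q a a + s%:R / L * (qform Q a x + qform Q x a)
  + s%:R * (s%:R - 1) / L ^+ 2 * qform Q x x
  + s%:R / L * \sum_j `|x j ord0| * Q j j.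
Proof.
move=> L L0; elim=> [|s IH] a.
  exists [tuple]; rewrite /signed_sum big_nil !addr0; lra.
pose W := \sum_j `|x j ord0| * Q j j.
(* [E k v] is the expectation of the form at [v] plus [k] independent random signed basis
   vectors. *)
pose E (k : nat) (v : 'cV[R]_p) := qform Q v v +
  k%:R / L * (qform Q v x + qform Q x v)
  + k%:R * (k%:R - 1) / L ^+ 2 * qform Q x x + k%:R / L * W.
pose eps j : bool := x j ord0 < 0.
pose b j := a + (-1) ^+ eps j *: (basis_vec R j).
have signx j : `|x j ord0| * (-1) ^+ eps j = x j ord0.
  by rewrite mulrC; apply/esym; exact: numEsign.
have sumr v : \sum_j x j ord0 * qform Q v (basis_vec R j) = qform Q v x.
  rewrite [in RHS](cV_delta x) qform_sumr; apply: eq_bigr => j _.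
  by rewrite qformZr.
have suml v : \sum_j x j ord0 * qform Q (basis_vec R j) v = qform Q x v.
  rewrite [in RHS](cV_delta x) qform_suml; apply: eq_bigr => j _.
  by rewrite qformZl.
(* Total expectation over the first draw: the mean of [E s (b j)] under the weights |x_j| / L is
   [E s.+1 a]. *)
have avg : \sum_j `|x j ord0| * (E s (b j) - E s.+1 a) = 0.
  have term j : `|x j ord0| * (E s (b j) - E s.+1 a) =
      x j ord0 * qform Q a (basis_vec R j) + x j ord0 * qform Q (basis_vec R j) a
      + s%:R / L * (x j ord0 * qform Q (basis_vec R j) x + x j ord0 * qform Q x (basis_vec R j))
      + `|x j ord0| * Q j j
      + `|x j ord0| * (E s a - E s.+1 a).
    have sq : (-1) ^+ eps j * (-1) ^+ eps j = 1 :> R by rewrite -expr2 sqrr_sign.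
    rewrite /E /b !(qformDl, qformDr, qformZl, qformZr) qform_delta.
    rewrite [_ * (_ * Q j j)]mulrA sq mul1r; move: (signx j).
    have [u uE] : exists u, u = `|x j ord0| by eexists.
    rewrite -uE; move: ((-1) ^+ eps j) (x j ord0) => e y <-.
    move: (s%:R / L) (s.+1%:R / L) (s%:R * (s%:R - 1) / L ^+ 2)
      (s.+1%:R * (s.+1%:R - 1) / L ^+ 2) => c1 c2 c3 c4.
    ring.
  rewrite (eq_bigr _ (fun j _ => term j)) !big_split /= -mulr_sumr big_split /=.
  rewrite sumr suml suml sumr -/W -mulr_suml -/L /E -natr1.
  by field; rewrite gt_eqF.
(* Some draw is not above the mean, for otherwise all weights |x_j| would vanish, against
   [0 < L]. *)
have [j bj] : exists j, E s (b j) <= E s.+1 a.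
  have [//|nex] := pselect (exists j, E s (b j) <= E s.+1 a).
  have all_gt j : E s.+1 a < E s (b j).
    by rewrite ltNge; apply/negP => bj; apply: nex; exists j.
  have nonneg j : true -> 0 <= `|x j ord0| * (E s (b j) - E s.+1 a).
    by move=> _; rewrite mulr_ge0// subr_ge0 ltW.
  have x0 j : `|x j ord0| = 0.
    have /eqP : `|x j ord0| * (E s (b j) - E s.+1 a) = 0.
      exact: (psumr_eq0P nonneg avg).
    by rewrite mulf_eq0 subr_eq0 (gt_eqF (all_gt j)) orbF => /eqP.
  by move: L0; rewrite /L big1 ?ltxx// => j _; exact: x0.
have [t tE] := IH (b j).
exists [tuple of (j, eps j) :: t].
rewrite /signed_sum big_cons addrA; apply: le_trans bj.
exact: tE.
Qed.

Lemma sqnorm2E (R : realType) n (v : 'cV[R]_n) : sqnorm2 v = (v^T *m v) ord0 ord0.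
Proof. by rewrite !mxE; apply: eq_bigr => i _; rewrite mxE. Qed.

Lemma qform_gram (R : realType) m p (X : 'M[R]_(m, p)) c (v : 'cV[R]_p) :
  qform (X^T *m X - c%:M) v v = sqnorm2 (X *m v) - c * sqnorm2 v.
Proof.
rewrite /qform !sqnorm2E mulmxBr mulmxBl trmx_mul !mulmxA mxE; congr (_ + _).
by rewrite mul_mx_scalar -scalemxAl !mxE.
Qed.

Lemma gram_diag (R : realType) m p (X : 'M[R]_(m, p)) j :
  (X^T *m X) j j = sqnorm2 (col j X).
Proof. by rewrite !mxE; apply: eq_bigr => i _; rewrite !mxE. Qed.

(** Maurey's bound for the form X^T X - c I: it is nonnegative at all signed sums, hence so is the
    average, whose diagonal part is controlled by L D. With [s.+2] draws the off-diagonal weight is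
    (s+2)(s+1) / L^2; multiplying by L^2 / (s+2) leaves the factor [s.+1]. *)
Lemma restricted_eigenvalue (R : realType) m p (X : 'M[R]_(m, p)) (c D : R)
    s (h : 'cV[R]_p) :
  0 <= c ->
  (forall t : s.+2.-tuple ('I_p * bool),
    c * sqnorm2 (signed_sum R t) <= sqnorm2 (X *m signed_sum R t)) ->
  (forall j, sqnorm2 (col j X) <= D) ->
  c * sqnorm2 h * s.+1%:R <=
  sqnorm2 (X *m h) * s.+1%:R + D * (\sum_j `|h j ord0|) ^+ 2.
Proof.
move=> c0 Xc XD; set L := \sum_j `|h j ord0|.
have [L0|L0] := ltP 0 L; last first.
  have h0 : h = 0.
    apply/colP => j; rewrite mxE; apply/eqP; rewrite -normr_le0.
    apply: le_trans L0; rewrite /L (bigD1 j)//= lerDl.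
    by rewrite sumr_ge0.
  have -> : L = 0 by rewrite /L big1// => j _; rewrite h0 mxE normr0.
  rewrite h0 mulmx0 /sqnorm2 !big1 ?mulr0 ?mul0r ?expr0n ?mulr0 ?addr0//;
    by move=> i _; rewrite mxE expr0n.
pose Q := X^T *m X - c%:M.
have [t] := maurey Q L0 s.+2 0.
rewrite add0r qform0l qform0r qform0l addr0 mulr0 !add0r !qform_gram -/L => tE.
have Q0 := le_trans (_ : 0 <= _) tE.
have {Q0 tE}: 0 <= s.+2%:R * (s.+2%:R - 1) / L ^+ 2 *
    (sqnorm2 (X *m h) - c * sqnorm2 h) +
    s.+2%:R / L * \sum_j `|h j ord0| * Q j j.
  by apply: Q0; rewrite subr_ge0.
have : \sum_j `|h j ord0| * Q j j <= L * D.
  rewrite /L mulr_suml ler_sum// => j _; rewrite ler_wpM2l//.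
  rewrite /Q mxE gram_diag; apply: le_trans (XD j).
  by rewrite gerDl !mxE eqxx mulr1n oppr_le0.
move: (\sum_j _ * _) (sqnorm2 (X *m h)) (sqnorm2 h) => W x y WD.
rewrite -[s.+2%:R - 1]/(s.+2%:R - 1%:R) -natrB// subn1 /=.
have s2 : 0 < s.+2%:R :> R by rewrite ltr0n.
move/(ler_wpM2l (ltW (divr_gt0 (exprn_gt0 2 L0) s2))).
have -> : L ^+ 2 / s.+2%:R * (s.+2%:R * s.+1%:R / L ^+ 2 * (x - c * y) +
    s.+2%:R / L * W) = s.+1%:R * (x - c * y) + L * W.
  by field; rewrite !gt_eqF.
rewrite mulr0 => H.
have := ler_wpM2l (ltW L0) WD.
lra.
Qed.

(** * Deterministic analysis of the Lasso *)

Lemma cauchy_schwarz_sum (R : realType) (I : finType) (a b : I -> R) :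
  (\sum_i a i * b i) ^+ 2 <= (\sum_i a i ^+ 2) * (\sum_i b i ^+ 2).
Proof.
set A := \sum_i a i ^+ 2; set B := \sum_i b i ^+ 2; set C := \sum_i _.
have A0 : 0 <= A by apply: sumr_ge0 => i _; rewrite sqr_ge0.
have B0 : 0 <= B by apply: sumr_ge0 => i _; rewrite sqr_ge0.
have [Bp|Bn] := ltP 0 B; last first.
  have Bz : B = 0 by apply/le_anti/andP.
  have b0 i : b i = 0.
    apply/eqP; rewrite -sqrf_eq0; apply/eqP.
    by apply: (psumr_eq0P _ Bz) => // j _; rewrite sqr_ge0.
  by rewrite /C big1 ?expr0n/= ?Bz ?mulr0// => i _; rewrite b0 mulr0.
have : 0 <= \sum_i (a i * B - b i * C) ^+ 2.
  by apply: sumr_ge0 => i _; rewrite sqr_ge0.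
have -> : \sum_i (a i * B - b i * C) ^+ 2 = B * (A * B - C ^+ 2).
  have term i : (a i * B - b i * C) ^+ 2 =
      B ^+ 2 * a i ^+ 2 + (- (2 * B * C)) * (a i * b i) + C ^+ 2 * b i ^+ 2.
    by ring.
  rewrite (eq_bigr _ (fun i _ => term i)) !big_split /= -!mulr_sumr.
  by rewrite -/A -/B -/C; ring.
by rewrite pmulr_rge0// subr_ge0.
Qed.

Lemma norm2_ge0 (R : realType) n (v : 'cV[R]_n) : 0 <= norm2 v.
Proof. exact: sqrtr_ge0. Qed.

Lemma sqr_norm2 (R : realType) n (v : 'cV[R]_n) : norm2 v ^+ 2 = sqnorm2 v.
Proof. by rewrite sqr_sqrtr// sqnorm2_ge0. Qed.

Lemma dot_le_norm2 (R : realType) n (u v : 'cV[R]_n) :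
  `|\sum_i u i ord0 * v i ord0| <= norm2 u * norm2 v.
Proof.
rewrite -ler_sqr ?nnegrE ?mulr_ge0 ?norm2_ge0//.
rewrite exprMn !sqr_norm2 real_normK ?num_real//.
exact: cauchy_schwarz_sum.
Qed.

Lemma sqnorm2B (R : realType) n (u v : 'cV[R]_n) :
  sqnorm2 (u - v) = sqnorm2 u - 2 * (\sum_i u i ord0 * v i ord0) + sqnorm2 v.
Proof.
rewrite /sqnorm2 mulr_sumr -sumrB -big_split /=; apply: eq_bigr => i _.
by rewrite !mxE; ring.
Qed.

Lemma sqnorm2_le_2B (R : realType) n (u v : 'cV[R]_n) :
  sqnorm2 v <= 2 * sqnorm2 (u - v) + 2 * sqnorm2 u.
Proof.
rewrite /sqnorm2 !mulr_sumr -big_split /=; apply: ler_sum => i _.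
rewrite !mxE; have := sqr_ge0 (2 * u i ord0 - v i ord0); lra.
Qed.

Section lasso.
Context (R : realType) (m p : nat) (lambda : R) (X : 'M[R]_(m, p)).
Implicit Types (beta b h : 'cV[R]_p) (e : 'cV[R]_m).

Let s j := norm2 (col j X) / Num.sqrt m%:R.

Let s_ge0 j : 0 <= s j.
Proof. by rewrite divr_ge0 ?norm2_ge0 ?sqrtr_ge0. Qed.

(** With h = b - beta, |beta_j| - |b_j| is at most |h_j| on the support of [beta] and equals -|h_j|
    off it; adding the full weighted norm of h to both sides leaves twice its support part. The
    residual stays a single square, so the inner product of [e] with X h is never isolated. *)
Lemma lasso_basic beta b e : 0 <= lambda ->
  lasso_obj lambda X (X *m beta + e) b <=
    lasso_obj lambda X (X *m beta + e) beta ->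
  sqnorm2 (e - X *m (b - beta)) / m%:R
    + lambda * \sum_j s j * `|(b - beta) j ord0| <=
  sqnorm2 e / m%:R
    + 2 * lambda * \sum_(j | beta j ord0 != 0) s j * `|(b - beta) j ord0|.
Proof.
move=> l0; rewrite /lasso_obj.
have -> : X *m beta + e - X *m b = e - X *m (b - beta).
  by rewrite mulmxBr opprB addrA [e + _]addrC.
have -> : X *m beta + e - X *m beta = e by rewrite addrC addKr.
suff : \sum_j s j * `|(b - beta) j ord0| <=
    2 * (\sum_(j | beta j ord0 != 0) s j * `|(b - beta) j ord0|) +
    \sum_(j < p) s j * `|b j ord0| - \sum_(j < p) s j * `|beta j ord0|.
  rewrite /s => /(ler_wpM2l l0); lra.
rewrite mulr_sumr [in leRHS]big_mkcond -big_split -sumrB /=.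
apply: ler_sum => j _; rewrite !mxE.
have sj := s_ge0 j.
have [->|bj] := eqVneq (beta j ord0) 0.
  by rewrite normr0 subr0 mulr0 add0r subr0.
have : `|beta j ord0| <= `|b j ord0 - beta j ord0| + `|b j ord0|.
  by rewrite -{1}(subKr (b j ord0) (beta j ord0)) (le_trans (ler_normB _ _))// addrC.
by move=> /(ler_wpM2l sj); rewrite /=; lra.
Qed.

End lasso.

(** The penalty weights are the column norms, so Cauchy-Schwarz, column by column, bounds the inner
    product of [e] with X b by |e| sqrt m T, where [T] is the weighted l1 norm of [b]. As 2 |e| <
    lambda sqrt m, this forces T = 0, and nonzero columns then give b = 0. *)
Lemma lasso_null (R : realType) m p (lambda : R) (X : 'M[R]_(m, p)) b
    (e : 'cV[R]_m) :
  (0 < m)%N -> (forall j, 0 < sqnorm2 (col j X)) -> 0 < lambda ->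
  4 * sqnorm2 e < lambda ^+ 2 * m%:R ->
  lasso_obj lambda X e b <= lasso_obj lambda X e 0 -> b = 0.
Proof.
move=> m0 X0 l0 el obj.
have mR : 0 < m%:R :> R by rewrite ltr0n.
have := @lasso_basic _ _ _ lambda X 0 b e (ltW l0).
rewrite mulmx0 add0r subr0 => /(_ obj).
rewrite [X in _ + 2 * _ * X]big1; last by move=> j; rewrite mxE eqxx.
rewrite mulr0 addr0 sqnorm2B; set C := \sum_(i < m) _; set T := \sum_(j < p) _.
set r : R := Num.sqrt m%:R => H.
have r0 : 0 < r by rewrite sqrtr_gt0.
have rE : r ^+ 2 = m%:R by rewrite sqr_sqrtr// ltW.
have CT : C <= norm2 e * (r * T).
  have -> : C = \sum_j b j ord0 * (\sum_i e i ord0 * col j X i ord0).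
    rewrite /C; under eq_bigr do rewrite mxE mulr_sumr.
    rewrite exchange_big /=; apply: eq_bigr => j _; rewrite mulr_sumr.
    by apply: eq_bigr => i _; rewrite !mxE; ring.
  rewrite /T !mulr_sumr; apply: ler_sum => j _.
  apply: le_trans (ler_norm _) _; rewrite normrM.
  have -> : norm2 e * (r * (norm2 (col j X) / r * `|b j ord0|)) =
      `|b j ord0| * (norm2 e * norm2 (col j X)).
    by field; rewrite gt_eqF.
  by rewrite ler_wpM2l// dot_le_norm2.
have T0 : 0 <= T.
  by apply: sumr_ge0 => j _; rewrite mulr_ge0// divr_ge0 ?norm2_ge0// ltW.
have el' : 2 * norm2 e < lambda * r.
  rewrite -ltr_sqr ?nnegrE ?mulr_ge0 ?norm2_ge0 ?ltW//.
  by rewrite !exprMn sqr_norm2 rE -natrX.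
have HH : lambda * m%:R * T <= 2 * norm2 e * r * T.
  have : (sqnorm2 e - 2 * C + sqnorm2 (X *m b)) / m%:R + lambda * T <=
    sqnorm2 e / m%:R by [].
  move=> /(ler_wpM2l (ltW mR)).
  rewrite mulrDr !(mulrC m%:R (_ / m%:R)) !divfK ?gt_eqF//.
  have := sqnorm2_ge0 (X *m b); lra.
have Tz : T = 0.
  apply/le_anti/andP; split => //; rewrite leNgt; apply/negP => Tp.
  have : lambda * m%:R * T > 2 * norm2 e * r * T.
    rewrite ltr_pM2r// -rE expr2 mulrA ltr_pM2r//.
  by rewrite ltNge HH.
apply/colP => j; rewrite mxE; apply/eqP; rewrite -normr_eq0.
have : norm2 (col j X) / r * `|b j ord0| = 0.
  by apply: (psumr_eq0P _ Tz) => // k _; rewrite mulr_ge0// divr_ge0 ?norm2_ge0// ltW.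
move/eqP; rewrite mulf_eq0 gt_eqF//= divr_gt0// sqrtr_gt0; exact: X0.
Qed.

(** The proof of [lasso_error_arith] ends with (kap / 4) |h|_2^2 bounded by the bracket; its terms
    stem from the noise energy, from the noise part of |h|_1^2 and from the penalty on the
    support. *)
Definition lasso_radius (R : realType) (sigma A kap D c : R) : R :=
  4 / kap * (16 * sigma ^+ 2 + 16 * D * sigma ^+ 2 / kap
             + 16 * (A ^+ 2 * sigma ^+ 2 * D * c) / kap).

(** Dictionary, with h = b - beta: H = |h|_2^2, l = |h|_1, N = |e|^2 / m, B = |e - X h|^2 / m, x =
    |X h|^2 / m, rho = log p / m; S1 and S2 are the weighted l1 norms of h, overall and on the
    support of [beta]. *)
Lemma lasso_error_arith (R : realType) (sigma A kap D c rho k H N B lam S1 S2 l x : R) :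
  0 < sigma -> 2 <= A ^+ 2 -> 0 < kap -> 0 < D -> 0 <= c -> 0 < rho -> 0 <= H ->
  0 <= N -> 0 <= B -> 0 <= lam -> 0 <= l -> 0 <= S2 ->
  lam ^+ 2 = A ^+ 2 * rho * sigma ^+ 2 ->
  16 * D ^+ 2 * c <= kap ^+ 2 -> k * rho <= c -> N <= 4 * sigma ^+ 2 ->
  B + lam * S1 <= N + 2 * lam * S2 ->
  Num.sqrt kap * l <= S1 -> S2 ^+ 2 <= D * (k * H) ->
  x <= 2 * B + 2 * N -> kap * H <= x + D * rho * l ^+ 2 ->
  H <= lasso_radius sigma A kap D c.
Proof.
move=> s0 A2 k0 D0 c0 r0 H0 N0 B0 lam0 l0 S20 lamE Dc krho N4 basic r0l S2k xB RE.
have As0 : 0 < A ^+ 2 * sigma ^+ 2.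
  by rewrite mulr_gt0 ?(exprn_gt0 2 s0)//; lra.
pose w := lam * S2; have w0 : 0 <= w by rewrite mulr_ge0.
have wH : w ^+ 2 <= A ^+ 2 * sigma ^+ 2 * D * c * H.
  rewrite /w exprMn lamE.
  have s1 := ler_wpM2l (ltW (mulr_gt0 As0 r0)) S2k.
  have s2 := ler_wpM2l (mulr_ge0 (ltW (mulr_gt0 As0 D0)) H0) krho.
  lra.
have lamS1 : lam * (Num.sqrt kap * l) <= N + 2 * w.
  have := ler_wpM2l lam0 r0l; rewrite /w; lra.
(* The penalty alone controls l. After squaring and dividing by A^2 sigma^2, the bound A^2 >= 2
   turns 32 sigma^4 / (A^2 sigma^2) into at most 16 sigma^2. *)
have kl : kap * rho * l ^+ 2 <= 16 * sigma ^+ 2 + 8 * D * c * H.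
  have sq : (lam * (Num.sqrt kap * l)) ^+ 2 <= (N + 2 * w) ^+ 2.
    rewrite lerXn2r// nnegrE ?mulr_ge0 ?sqrtr_ge0//; lra.
  rewrite !exprMn lamE (sqr_sqrtr (ltW k0)) in sq.
  have sq2 : (N + 2 * w) ^+ 2 <= 2 * N ^+ 2 + 8 * w ^+ 2.
    have := sqr_ge0 (N - 2 * w); lra.
  have N2 : N ^+ 2 <= (4 * sigma ^+ 2) ^+ 2.
    by rewrite lerXn2r// nnegrE mulr_ge0// sqr_ge0.
  have s4 : 32 * (sigma ^+ 2) ^+ 2 <= 16 * sigma ^+ 2 * (A ^+ 2 * sigma ^+ 2).
    have := ler_wpM2l (sqr_ge0 (sigma ^+ 2)) A2; lra.
  rewrite -(ler_pM2l As0); lra.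
(* The condition [16 * D ^+ 2 * c <= kap ^+ 2] is what keeps the H term within half of [kap * H]. *)
have Dl : D * rho * l ^+ 2 <= 16 * D * sigma ^+ 2 / kap + kap / 2 * H.
  rewrite -(ler_pM2l k0).
  have -> : kap * (16 * D * sigma ^+ 2 / kap + kap / 2 * H) =
    16 * D * sigma ^+ 2 + kap ^+ 2 / 2 * H by field; rewrite gt_eqF.
  have s1 := ler_wpM2l (ltW D0) kl.
  have s2 := ler_wpM2r H0 Dc.
  lra.
have Bw : B <= N + 2 * w.
  have S10 : 0 <= S1 by apply: le_trans r0l; rewrite mulr_ge0// sqrtr_ge0.
  have := mulr_ge0 lam0 S10; rewrite /w; lra.
rewrite /lasso_radius.
have E00 : 0 <= A ^+ 2 * sigma ^+ 2 * D * c.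
  exact: mulr_ge0 (ltW (mulr_gt0 As0 D0)) c0.
move: (A ^+ 2 * sigma ^+ 2 * D * c) wH E00 => E wH E00.
(* Weighted AM-GM spending only a quarter of [kap * H]; with the half spent above, a quarter remains
   on the left. *)
have w4 : 4 * w <= kap / 4 * H + 16 * E / kap.
  have [E0|E0] := ltP 0 E; last first.
    have w20 : w ^+ 2 <= 0 by apply: le_trans wH _; nra.
    have -> : w = 0 by apply/eqP; rewrite -sqrf_eq0 eq_le w20 sqr_ge0.
    have -> : E = 0.
      by apply/le_anti; rewrite E0.
    by rewrite !(mulr0, mul0r) addr0 mulr_ge0// divr_ge0// ltW.
  have amgm : 4 * w <= kap / (4 * E) * w ^+ 2 + 16 * E / kap.
    have : 0 <= (kap * w - 8 * E) ^+ 2 / (4 * E * kap).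
      by apply: divr_ge0; [exact: sqr_ge0|rewrite ltW// !mulr_gt0].
    have -> : (kap * w - 8 * E) ^+ 2 / (4 * E * kap) =
      kap / (4 * E) * w ^+ 2 - 4 * w + 16 * E / kap.
      by field; rewrite !gt_eqF.
    lra.
  apply: le_trans amgm _; rewrite lerD2r.
  have -> : kap / 4 * H = kap / (4 * E) * (E * H) by field; rewrite gt_eqF.
  by rewrite ler_wpM2l// divr_ge0 ?mulr_ge0 ?(ltW E0) ?(ltW k0).
have : kap / 4 * H <= 16 * sigma ^+ 2 + 16 * D * sigma ^+ 2 / kap + 16 * E / kap.
  lra.
have k4 : 0 <= 4 / kap by rewrite divr_ge0// ltW.
move=> /(ler_wpM2l k4); have -> : 4 / kap * (kap / 4 * H) = H.
  by field; rewrite gt_eqF.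
by [].
Qed.

Lemma lasso_error_bound (R : realType) m p (X : 'M[R]_(m, p)) (e : 'cV[R]_m)
    (beta b : 'cV[R]_p) (sigma A kap D c rho lam : R) (k : nat) :
  (0 < m)%N -> 0 < sigma -> 2 <= A ^+ 2 -> 0 < kap -> 0 < D -> 0 <= c ->
  0 < rho -> 0 <= lam -> lam ^+ 2 = A ^+ 2 * rho * sigma ^+ 2 ->
  16 * D ^+ 2 * c <= kap ^+ 2 -> k%:R * rho <= c -> (norm0 beta <= k)%N ->
  sqnorm2 e <= 4 * sigma ^+ 2 * m%:R ->
  (forall j, kap * m%:R <= sqnorm2 (col j X) <= D * m%:R) ->
  (forall h, kap * m%:R * sqnorm2 h <=
     sqnorm2 (X *m h) + D * m%:R * rho * (\sum_j `|h j ord0|) ^+ 2) ->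
  lasso_obj lam X (X *m beta + e) b <= lasso_obj lam X (X *m beta + e) beta ->
  sqnorm2 (b - beta) <= lasso_radius sigma A kap D c.
Proof.
move=> m0 s0 A2 k0 D0 c0 r0 lam0 lamE Dc krho bk eN Xcol RE obj.
have mR : 0 < m%:R :> R by rewrite ltr0n.
have basic := lasso_basic lam0 obj.
move: basic; set h := b - beta.
set S1 := \sum_(j < p) _; set S2 := \sum_(j < p | _) _ => basic.
have scol j : Num.sqrt kap <= norm2 (col j X) / Num.sqrt m%:R <= Num.sqrt D.
  have sm : 0 < Num.sqrt m%:R :> R by rewrite sqrtr_gt0.
  have /andP[lo hi] := Xcol j.
  rewrite ler_pdivlMr// ler_pdivrMr// -!sqrtrM ?(ltW k0) ?(ltW D0)//.
  by rewrite /norm2 !ler_wsqrtr.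
apply: (@lasso_error_arith _ _ _ _ _ _ rho k%:R _ (sqnorm2 e / m%:R)
    (sqnorm2 (e - X *m h) / m%:R) lam S1 S2 (\sum_j `|h j ord0|)
    (sqnorm2 (X *m h) / m%:R)) => //.
- exact: sqnorm2_ge0.
- by rewrite divr_ge0 ?sqnorm2_ge0// ltW.
- by rewrite divr_ge0 ?sqnorm2_ge0// ltW.
- by rewrite sumr_ge0.
- by apply: sumr_ge0 => j _; rewrite mulr_ge0// divr_ge0 ?norm2_ge0 ?sqrtr_ge0.
- by rewrite ler_pdivrMr.
- rewrite /S1 mulr_sumr; apply: ler_sum => j _; rewrite ler_wpM2r//.
  by have /andP[] := scol j.
(* Cauchy-Schwarz against the indicator of the support produces the factor [norm0 beta]. *)
- pose T j : R := (beta j ord0 != 0)%:R.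
  have S2T : S2 <= Num.sqrt D * \sum_j `|h j ord0| * T j.
    rewrite /S2 big_mkcond mulr_sumr; apply: ler_sum => j _; rewrite /T.
    case: ifP => _; last by rewrite !mulr0.
    by rewrite mulr1 ler_wpM2r//; have /andP[] := scol j.
  apply: (@le_trans _ _ ((Num.sqrt D * \sum_j `|h j ord0| * T j) ^+ 2)).
    rewrite lerXn2r// nnegrE.
      by apply: sumr_ge0 => j _; rewrite mulr_ge0// divr_ge0 ?norm2_ge0 ?sqrtr_ge0.
    rewrite mulr_ge0 ?sqrtr_ge0// sumr_ge0// => j _.
    by rewrite mulr_ge0// ler0n.
  rewrite exprMn (sqr_sqrtr (ltW D0)) ler_wpM2l ?(ltW D0)//.
  apply: le_trans (cauchy_schwarz_sum _ _) _.
  have -> : \sum_j `|h j ord0| ^+ 2 = sqnorm2 h.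
    by apply: eq_bigr => j _; rewrite real_normK ?num_real.
  rewrite mulrC ler_wpM2r ?sqnorm2_ge0//.
  have -> : \sum_j T j ^+ 2 = (norm0 beta)%:R.
    rewrite /norm0 -sum1_card natr_sum [RHS]big_mkcond /=.
    apply: eq_bigr => j _; rewrite /T inE.
    by case: (beta j ord0 == 0); rewrite ?expr1n ?expr0n.
  by rewrite ler_nat.
- rewrite [X in _ <= X + _]mulrA [X in _ <= _ + X]mulrA -mulrDl ler_wpM2r ?invr_ge0 ?(ltW mR)//.
  exact: sqnorm2_le_2B.
- rewrite -(ler_pM2r mR); apply: le_trans.
    by have := RE h; rewrite mulrAC; apply.
  by rewrite mulrDl divfK ?gt_eqF// lerD2l; lra.
Qed.

(** * The first subsample *)

Lemma measure_exists_sum d (T : measurableType d) (R : realType)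
    (P : probability T R) (I : finType) (A : I -> set T) :
  (forall i, measurable (A i)) ->
  (P [set x | exists i, A i x] <= \sum_i P (A i))%E.
Proof.
move=> mA.
have aux (s : seq I) : measurable (\big[setU/set0]_(i <- s) A i) /\
    (P (\big[setU/set0]_(i <- s) A i) <= \sum_(i <- s) P (A i))%E.
  elim: s => [|i s [ms Ps]]; first by rewrite !big_nil measure0.
  rewrite !big_cons; split; first exact: measurableU.
  by apply: (le_trans (measureU2 _ (mA i) ms)); rewrite leeD.
have -> : [set x | exists i, A i x] = \big[setU/set0]_(i <- enum I) A i.
  apply/seteqP; split => x.
    by move=> [i Aix]; rewrite -bigcup_seq; exists i => //=; rewrite mem_enum.
  by rewrite -bigcup_seq => -[i _ Aix]; exists i.
by apply: (le_trans (aux _).2); rewrite big_enum.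
Qed.

Lemma measure_exists_le d (T : measurableType d) (R : realType)
    (P : probability T R) (I : finType) (A : I -> set T) (c : R) :
  (forall i, measurable (A i)) -> (forall i, (P (A i) <= c%:E)%E) ->
  (P [set x | exists i, A i x] <= (#|I|%:R * c)%:E)%E.
Proof.
move=> mA PA; apply: (le_trans (measure_exists_sum _ mA)).
have -> : (#|I|%:R * c)%:E = (\sum_(i : I) c%:E)%E.
  by rewrite sumEFin sumr_const mulr_natl.
by apply: lee_sum => i _; exact: PA.
Qed.

Lemma sqnorm2_col_mx (R : realType) m n (u : 'cV[R]_m) (v : 'cV[R]_n) :
  sqnorm2 (col_mx u v) = sqnorm2 u + sqnorm2 v.
Proof.
rewrite /sqnorm2 big_split_ord /=; congr (_ + _); apply: eq_bigr => i _.
  by rewrite col_mxEu.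
by rewrite col_mxEd.
Qed.

Lemma sqnorm20 (R : realType) n : sqnorm2 (0 : 'cV[R]_n) = 0.
Proof. by rewrite /sqnorm2 big1// => i _; rewrite mxE expr0n. Qed.

Lemma sqnorm2Z (R : realType) n a (v : 'cV[R]_n) :
  sqnorm2 (a *: v) = a ^+ 2 * sqnorm2 v.
Proof.
by rewrite /sqnorm2 mulr_sumr; apply: eq_bigr => i _; rewrite mxE exprMn.
Qed.

Lemma sqnorm2_basis (R : realType) n (j : 'I_n) : sqnorm2 (basis_vec R j) = 1.
Proof.
rewrite /sqnorm2 (bigD1 j)//= big1 ?addr0; first by rewrite mxE !eqxx expr1n.
by move=> i ij; rewrite mxE (negbTE ij) expr0n.
Qed.

Lemma signed_sum_nseq (R : realType) p n (j : 'I_p) :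
  signed_sum R (nseq n (j, false)) = n%:R *: basis_vec R j.
Proof.
elim: n => [|n IH]; first by rewrite /signed_sum big_nil scale0r.
rewrite /signed_sum big_cons -/(signed_sum R _) IH expr0.
by rewrite -scalerDl -natr1 addrC.
Qed.

Lemma mulmx_basis (R : realType) m n (X : 'M[R]_(m, n)) j :
  X *m basis_vec R j = col j X.
Proof. by rewrite /basis_vec colE. Qed.

Lemma lsubmx_mul (R : realType) m p (U : 'M[R]_(m, p + 1)) (v : 'cV[R]_p) :
  lsubmx U *m v = U *m col_mx v 0.
Proof. by rewrite -{2}[U]hsubmxK mul_row_col mulmx0 addr0. Qed.

Lemma rsubmx_mul (R : realType) m p (U : 'M[R]_(m, p + 1)) :
  rsubmx U = U *m col_mx 0 1%:M :> 'cV[R]_m.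
Proof. by rewrite -{2}[U]hsubmxK mul_row_col mulmx0 add0r mulmx1. Qed.

Lemma sqnorm2_1 (R : realType) : sqnorm2 (1%:M : 'cV[R]_1) = 1.
Proof. by rewrite /sqnorm2 big_ord1 mxE expr1n. Qed.

(* [eig_const] makes the lower tail of one chi-square beat the union bound over
   [exp (34 m)] signed sums (see [bad_design_small]), and [col_const] its upper
   tail beat the one over [p <= exp (8 m)] columns. *)
Definition eig_const (R : realType) : R := 2 * expR (- 74).
Definition col_const (R : realType) : R := 44.
(** The largest [c] allowed by [16 * D ^+ 2 * c <= kap ^+ 2] in [lasso_error_bound]. *)
Definition sparsity_const (R : realType) : R := eig_const R ^+ 2 / (16 * col_const R ^+ 2).

Lemma eig_const_gt0 (R : realType) : 0 < eig_const R.
Proof. by rewrite mulr_gt0// expR_gt0. Qed.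

Lemma eig_const_le1 (R : realType) : eig_const R <= 1.
Proof.
rewrite /eig_const expRN -(ler_pM2r (expR_gt0 74)) -mulrA mulVf ?gt_eqF ?expR_gt0//.
by have := expR_ge1Dx (74 : R); lra.
Qed.

Lemma measurable_design (R : realType) m p v : measurable_fun setT
  (fun U : 'M[R]_(m, p + 1) => sqnorm2 (lsubmx U *m v)).
Proof.
under eq_fun do rewrite lsubmx_mul; exact: measurable_sqnorm2_mul.
Qed.

(** [U] stands for the first subsample: [p] design columns, then the noise divided by its standard
    deviation. At level 4 the upper tail is exp(-m/2). *)
Definition noise_event (R : realType) m p : set 'M[R]_(m, p + 1) :=
  [set U | 4 * m%:R <= sqnorm2 (rsubmx U)].

Lemma measurable_noise_event (R : realType) m p : measurable (@noise_event R m p).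
Proof.
apply: measurable_ler => //; under eq_fun do rewrite rsubmx_mul.
exact: measurable_sqnorm2_mul.
Qed.

Section good_design.
Context (R : realType) (m p : nat).
Variable G : probability 'M[R]_(m, p + 1) R.
Hypotheses (GG : gaussian_entries G) (m0 : (0 < m)%N) (p1 : (1 < p)%N).

Let mR : 0 < m%:R :> R. Proof. by rewrite ltr0n. Qed.
Let pR : 0 < p%:R :> R. Proof. by rewrite ltr0n ltnW. Qed.
Let lnp : 0 < ln p%:R :> R. Proof. by rewrite ln_gt0// ltr1n. Qed.

Local Notation noise := (@noise_event R m p).

Let mdesign v : measurable_fun setT
  (fun U : 'M[R]_(m, p + 1) => sqnorm2 (lsubmx U *m v)).
Proof. exact: measurable_design. Qed.

Let mnoise : measurable noise.
Proof. exact: measurable_noise_event. Qed.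

Lemma noise_event_le : (G noise <= (expR (- (m%:R / 2)))%:E)%E.
Proof.
have u1 : sqnorm2 (col_mx 0 1%:M : 'cV[R]_(p + 1)) = 1.
  by rewrite sqnorm2_col_mx sqnorm20 sqnorm2_1 add0r.
have := @gaussian_upper_tail _ _ _ _ (col_mx 0 1%:M) 4 GG.
rewrite u1 mulr1 => /(_ ltr01).
have -> : [set M : 'M[R]_(m, p + 1) | 4 * m%:R <= sqnorm2 (M *m col_mx 0 1%:M)]
    = noise.
  by apply/seteqP; split => U; rewrite /noise_event /= rsubmx_mul.
by congr (_ <= (expR (- _))%:E)%E; field.
Qed.

Lemma design_lower_tail v (a : R) : 0 < sqnorm2 v -> 0 <= a ->
  (G [set U | (sqnorm2 (lsubmx U *m v) <=
                 2 * expR (- a) * m%:R * sqnorm2 v)%R] <=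
   (expR (- ((a / 2 - 1) * m%:R)))%:E)%E.
Proof.
move=> v0 a0.
have uv : sqnorm2 (col_mx v (0 : 'cV[R]_1)) = sqnorm2 v.
  by rewrite sqnorm2_col_mx sqnorm20 addr0.
have := @gaussian_lower_tail _ _ _ _ (col_mx v 0) a GG.
rewrite uv => /(_ v0 a0).
by under eq_set do rewrite -lsubmx_mul.
Qed.

Lemma design_upper_tail v (D : R) : 0 < sqnorm2 v ->
  (G [set U | (D * m%:R * sqnorm2 v <= sqnorm2 (lsubmx U *m v))%R] <=
   (expR (- ((D / 4 - 1 / 2) * m%:R)))%:E)%E.
Proof.
move=> v0.
have uv : sqnorm2 (col_mx v (0 : 'cV[R]_1)) = sqnorm2 v.
  by rewrite sqnorm2_col_mx sqnorm20 addr0.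
have := @gaussian_upper_tail _ _ _ _ (col_mx v 0) D GG.
rewrite uv => /(_ v0).
by under eq_set do rewrite -lsubmx_mul.
Qed.

Let expR_half_le c : 1 / 2 <= c -> expR (- (c * m%:R)) <= expR (- (m%:R / 2)) :> R.
Proof. by move=> c2; rewrite ler_expR lerN2; have := ler_wpM2r (ltW mR) c2; lra. Qed.

(** The length of the signed sums, about m / log p, balances two costs: shorter sums worsen the
    |h|_1^2 term, longer ones make the (2p)^(s+2) vectors outnumber exp(C m). *)
Lemma bad_design_small : ln p%:R <= 8 * m%:R :> R ->
  exists Bad : set 'M[R]_(m, p + 1),
  [/\ measurable Bad, (G Bad <= (3 * expR (- (m%:R / 2)))%:E)%E &
   forall U, ~ Bad U ->
   [/\ sqnorm2 (rsubmx U) <= 4 * m%:R,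
     forall j, eig_const R * m%:R <= sqnorm2 (col j (lsubmx U)) <= col_const R * m%:R &
     forall h, eig_const R * m%:R * sqnorm2 h <= sqnorm2 (lsubmx U *m h) +
       col_const R * m%:R * (ln p%:R / m%:R) * (\sum_j `|h j ord0|) ^+ 2]].
Proof.
move=> small.
have mlp : 0 <= m%:R / ln p%:R :> R by rewrite divr_ge0 ?ltW.
pose s := Num.truncn (m%:R / ln p%:R : R).
have sle : s%:R <= m%:R / ln p%:R :> R by rewrite /s truncn_le.
have sgt : m%:R / ln p%:R < s.+1%:R :> R by rewrite /s truncnS_gt.
pose v (t : s.+2.-tuple ('I_p * bool)) : 'cV[R]_p := signed_sum R t.
pose BadT t := [set U : 'M[R]_(m, p + 1) |
  sqnorm2 (lsubmx U *m v t) < eig_const R * m%:R * sqnorm2 (v t)].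
pose BadC j := [set U : 'M[R]_(m, p + 1) |
  col_const R * m%:R * sqnorm2 (basis_vec R j) <= sqnorm2 (lsubmx U *m basis_vec R j)].
have mBadT t : measurable (BadT t).
  have -> : BadT t = ~` [set U : 'M[R]_(m, p + 1) |
      eig_const R * m%:R * sqnorm2 (v t) <= sqnorm2 (lsubmx U *m v t)].
    by apply/seteqP; split => U; rewrite /BadT /= ltNge => /negP.
  by apply: measurableC; exact: measurable_ler.
have mBadC j : measurable (BadC j) by exact: measurable_ler.
have PBadT : (G [set U | exists t, BadT t U] <= (expR (- (m%:R / 2)))%:E)%E.
  apply: le_trans.
    apply: (@measure_exists_le _ _ _ _ _ _ (expR (- ((74 / 2 - 1) * m%:R)))) => // t.
    (* A signed sum may cancel to 0; the strict inequality in [BadT] makes its event empty. *)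
    have [v0|v0] := ltP 0 (sqnorm2 (v t)); last first.
      have -> : BadT t = set0.
        apply/seteqP; split => // U; rewrite /BadT /=.
        have -> : sqnorm2 (v t) = 0 by apply/le_anti; rewrite v0 sqnorm2_ge0.
        by rewrite mulr0 ltNge sqnorm2_ge0.
      by rewrite measure0 lee_fin expR_ge0.
    apply: le_trans (design_lower_tail v0 _) => //.
    apply: le_measure; rewrite ?inE//; first exact: measurable_ler.
    by move=> U /=; rewrite /BadT /= => /ltW.
  rewrite lee_fin card_tuple card_prod card_ord card_bool.
  (* (2p)^(s+2) <= p^(2(s+2)) as p >= 2, then s log p <= m and 4 log p <= 32 m. *)
  apply: (@le_trans _ _ (expR (34 * m%:R) * expR (- ((74 / 2 - 1) * m%:R)))).
    rewrite ler_wpM2r ?expR_ge0// natrX natrM.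
    have p2 : (p%:R * 2 : R) <= expR (2 * ln p%:R).
      rewrite expRM_natl lnK ?posrE// expr2 ler_wpM2l ?(ltW pR)// ler_nat.
      by [].
    apply: (@le_trans _ _ (expR (2 * ln p%:R) ^+ s.+2)).
      by rewrite lerXn2r// nnegrE ?expR_ge0// mulr_ge0// ltW.
    rewrite -expRM_natl ler_expR.
    have : s%:R * ln p%:R <= m%:R :> R by rewrite -ler_pdivlMr.
    rewrite -[s.+2]addn2 natrD; lra.
  by rewrite -expRD; apply: le_trans (expR_half_le (c := 2) _); [rewrite ler_expR|]; lra.
have PBadC : (G [set U | exists j, BadC j U] <= (expR (- (m%:R / 2)))%:E)%E.
  apply: le_trans.
    apply: (@measure_exists_le _ _ _ _ _ _ (expR (- ((col_const R / 4 - 1 / 2) * m%:R)))) => // j.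
    by apply: design_upper_tail; rewrite sqnorm2_basis.
  rewrite lee_fin card_ord -{1}[p%:R]lnK ?posrE// -expRD.
  apply: le_trans (expR_half_le (c := 2) _); last lra.
  by rewrite ler_expR /col_const; have := mR; have := small; lra.
exists ([set U | exists t, BadT t U] `|` [set U | exists j, BadC j U] `|` @noise_event R m p).
have mT : measurable [set U | exists t, BadT t U] by exact: measurable_exists.
have mC : measurable [set U | exists j, BadC j U] by exact: measurable_exists.
split.
- by apply: measurableU => //; exact: measurableU.
- apply: (le_trans (measureU2 _ (measurableU _ _ mT mC) mnoise)).
  have -> : 3 * expR (- (m%:R / 2)) = expR (- (m%:R / 2)) +
    expR (- (m%:R / 2)) + expR (- (m%:R / 2)) :> R by ring.
  rewrite !EFinD leeD//; last exact: noise_event_le.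
  by rewrite (le_trans (measureU2 _ mT mC))// leeD.
- move=> U /not_orP[/not_orP[nT nC] nN].
  have goodT t : eig_const R * m%:R * sqnorm2 (v t) <= sqnorm2 (lsubmx U *m v t).
    by rewrite leNgt; apply/negP => H; apply: nT; exists t.
  have goodC j : sqnorm2 (col j (lsubmx U)) <= col_const R * m%:R.
    rewrite leNgt; apply/negP => H; apply: nC; exists j.
    by rewrite /BadC /= sqnorm2_basis mulr1 mulmx_basis ltW.
  split.
  + by rewrite leNgt; apply/negP => H; apply: nN; rewrite /noise_event /= ltW.
  + move=> j; rewrite goodC andbT.
    (* A constant tuple sums to a multiple of a basis vector, so the lower bound on columns is a
       case of the one on signed sums. *)
    have := goodT [tuple of nseq s.+2 (j, false)].
    have -> : v [tuple of nseq s.+2 (j, false)] = s.+2%:R *: basis_vec R j.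
      exact: signed_sum_nseq.
    rewrite -scalemxAr !sqnorm2Z sqnorm2_basis mulr1 mulmx_basis mulrC.
    by rewrite ler_pM2l// exprn_gt0// ltr0n.
  + move=> h.
    have := @restricted_eigenvalue _ _ _ (lsubmx U) (eig_const R * m%:R) (col_const R * m%:R)
      s h (mulr_ge0 (ltW (eig_const_gt0 R)) (ltW mR)) goodT goodC.
    have s1 : 0 < s.+1%:R :> R by rewrite ltr0n.
    move=> H; rewrite -(ler_pM2r s1); apply: le_trans H _.
    rewrite [leRHS]mulrDl lerD2l.
    have L0 : 0 <= (\sum_j `|h j ord0|) ^+ 2 by rewrite sqr_ge0.
    have ms : m%:R <= s.+1%:R * ln p%:R :> R.
      by rewrite -ler_pdivrMr// ltW.
    have -> : col_const R * m%:R * (ln p%:R / m%:R) * (\sum_j `|h j ord0|) ^+ 2 * s.+1%:R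
      = col_const R * (\sum_j `|h j ord0|) ^+ 2 * (s.+1%:R * ln p%:R).
      by field; rewrite gt_eqF.
    rewrite mulrAC ler_wpM2l// mulr_ge0// /col_const; lra.
Qed.
End good_design.

Lemma lasso_radius_ge0 (R : realType) (sigma A : R) :
  0 <= lasso_radius sigma A (eig_const R) (col_const R) (sparsity_const R).
Proof.
have k0 := eig_const_gt0 R; have d0 : 0 < col_const R by rewrite /col_const.
have c00 : 0 <= sparsity_const R by rewrite /sparsity_const divr_ge0 ?sqr_ge0// mulr_ge0// sqr_ge0.
rewrite /lasso_radius.
by do ![exact: sqr_ge0|exact: ler0n|exact: (ltW k0)|exact: (ltW d0)|done
       |apply: addr_ge0|apply: mulr_ge0|rewrite invr_ge0].
Qed.

Section lasso_good.
Context (R : realType) (m p : nat).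
Variable G : probability 'M[R]_(m, p + 1) R.
Hypotheses (GG : gaussian_entries G) (m0 : (0 < m)%N) (p1 : (1 < p)%N).

Let mR : 0 < m%:R :> R. Proof. by rewrite ltr0n. Qed.
Let pR : 0 < p%:R :> R. Proof. by rewrite ltr0n ltnW. Qed.
Let lnp : 0 < ln p%:R :> R. Proof. by rewrite ln_gt0// ltr1n. Qed.

(** Letting [a] grow with log p / m makes the tail exponent m + log p, which pays for the union over
    the columns whatever the size of [p]. *)
Lemma bad_design_large :
  exists Bad : set 'M[R]_(m, p + 1),
  [/\ measurable Bad, (G Bad <= (3 * expR (- (m%:R / 2)))%:E)%E &
   forall U, ~ Bad U -> sqnorm2 (rsubmx U) <= 4 * m%:R /\
     forall j, 0 < sqnorm2 (col j (lsubmx U))].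
Proof.
pose BadC j := [set U : 'M[R]_(m, p + 1) |
  sqnorm2 (lsubmx U *m basis_vec R j) <= 0].
pose a : R := 2 * (2 + ln p%:R / m%:R).
have mBadC j : measurable (BadC j).
  by apply: measurable_ler => //; exact: measurable_design.
have PBadC : (G [set U | exists j, BadC j U] <= (expR (- (m%:R / 2)))%:E)%E.
  apply: le_trans.
    apply: (@measure_exists_le _ _ _ _ _ _ (expR (- ((a / 2 - 1) * m%:R)))) => // j.
    have b0 : 0 < sqnorm2 (basis_vec R j) by rewrite sqnorm2_basis.
    have a0 : 0 <= a by rewrite mulr_ge0// addr_ge0// divr_ge0// ltW.
    apply: le_trans (design_lower_tail GG b0 a0).
    apply: le_measure; rewrite ?inE//.
      by apply: measurable_ler => //; exact: measurable_design.
    move=> U /= H; apply: le_trans H _.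
    by rewrite sqnorm2_basis mulr1 !mulr_ge0 ?expR_ge0.
  rewrite lee_fin card_ord -{1}[p%:R]lnK ?posrE// -expRD ler_expR.
  have -> : (a / 2 - 1) * m%:R = m%:R + ln p%:R :> R.
    by rewrite /a; field; rewrite gt_eqF.
  by have := mR; lra.
exists ([set U | exists j, BadC j U] `|` @noise_event R m p).
have mC : measurable [set U | exists j, BadC j U] by exact: measurable_exists.
have e0 : 0 <= expR (- (m%:R / 2)) :> R := expR_ge0 _.
split.
- by apply: measurableU => //; exact: measurable_noise_event.
- apply: (le_trans (measureU2 _ mC (@measurable_noise_event R m p))).
  apply: (le_trans (leeD PBadC (noise_event_le GG))).
  by rewrite -EFinD lee_fin; lra.
- move=> U /not_orP[nC nN]; split.
  + by rewrite leNgt; apply/negP => H; apply: nN; rewrite /noise_event /= ltW.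
  + move=> j; rewrite ltNge; apply/negP => H; apply: nC; exists j.
    by rewrite /BadC /= mulmx_basis.
Qed.

(** [Bad] is fixed before [sigma], [beta] and [b]: this gives uniformity over the parameters and
    allows any choice of minimizer, which is only compared with the true [beta]. *)
Lemma lasso_consistent : exists Bad : set 'M[R]_(m, p + 1),
  [/\ measurable Bad, (G Bad <= (3 * expR (- (m%:R / 2)))%:E)%E &
   forall U, ~ Bad U ->
   forall (sigma A : R) (beta b : 'cV[R]_p) (k : nat),
     0 < sigma -> 0 < A -> 2 <= A ^+ 2 -> (norm0 beta <= k)%N ->
     k%:R * (ln p%:R / m%:R) <= sparsity_const R ->
     let y := lsubmx U *m beta + sigma *: rsubmx U in
     lasso_obj (lasso_lambda A sigma m p) (lsubmx U) y b <=
       lasso_obj (lasso_lambda A sigma m p) (lsubmx U) y beta ->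
     sqnorm2 (b - beta) <= lasso_radius sigma A (eig_const R) (col_const R) (sparsity_const R)].
Proof.
have k0 := eig_const_gt0 R; have d0 : 0 < col_const R by rewrite /col_const.
have c00 : 0 <= sparsity_const R by rewrite /sparsity_const divr_ge0 ?sqr_ge0// mulr_ge0// sqr_ge0.
pose rho : R := ln p%:R / m%:R.
have rho0 : 0 < rho by rewrite divr_gt0.
have lamE (sigma A : R) : lasso_lambda A sigma m p ^+ 2 = A ^+ 2 * rho * sigma ^+ 2.
  by rewrite /lasso_lambda !exprMn sqr_sqrtr// ltW.
have [small|large] := leP (ln p%:R) (8 * m%:R : R).
  have [Bad [mBad PBad good]] := bad_design_small GG m0 p1 small.
  exists Bad; split=> // U /good[eN Xcol RE] sigma A beta b k s0 A0 A2 bk krho y obj.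
  apply: (lasso_error_bound (rho := rho) (k := k) m0 s0 A2 k0 d0 c00 rho0 _
    (lamE sigma A) _ krho bk _ Xcol RE obj).
  - by rewrite /lasso_lambda !mulr_ge0 ?sqrtr_ge0// ltW.
  - by rewrite /sparsity_const mulrC divfK// gt_eqF// mulr_gt0// exprn_gt0.
  - rewrite sqnorm2Z; have := ler_wpM2l (sqr_ge0 sigma) eN; lra.
have [Bad [mBad PBad good]] := bad_design_large.
exists Bad; split=> // U /good[eN X0] sigma A beta b k s0 A0 A2 bk krho y obj.
(* Since [sparsity_const] < 8 < rho, no k >= 1 is possible; and A^2 rho > 16 is the hypothesis of
   [lasso_null] for |e|^2 <= 4 sigma^2 m. *)
have rho8 : 8 < rho by rewrite /rho ltr_pdivlMr.
have c01 : sparsity_const R < 8.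
  rewrite /sparsity_const ltr_pdivrMr ?mulr_gt0 ?exprn_gt0//.
  have : eig_const R ^+ 2 <= 1 by rewrite expr_le1 ?eig_const_le1// ltW.
  rewrite /col_const; lra.
have kz : k = 0%N.
  case: k bk krho => // k _ krho; exfalso.
  have : 1 * rho <= k.+1%:R * rho by rewrite ler_wpM2r ?(ltW rho0)// ler1n.
  rewrite -/rho in krho; lra.
have bz : beta = 0.
  apply/colP => j; rewrite mxE; apply/eqP; apply/negPn/negP => bj.
  move: bk; rewrite kz leqn0 => /eqP/card0_eq/(_ j).
  by rewrite inE bj.
rewrite bz subr0; suff -> : b = 0 by rewrite sqnorm20 lasso_radius_ge0.
apply: (@lasso_null _ _ _ (lasso_lambda A sigma m p) (lsubmx U) b
  (sigma *: rsubmx U)) => //.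
- by rewrite /lasso_lambda !mulr_gt0 ?sqrtr_gt0.
- rewrite lamE sqnorm2Z.
  have s2 : 0 < sigma ^+ 2 by rewrite exprn_gt0.
  have h1 := ler_wpM2l (ltW s2) eN.
  have h2 : 16 < A ^+ 2 * rho.
    have := ler_wpM2r (ltW rho0) A2; lra.
  have h3 : 16 * (sigma ^+ 2 * m%:R) < A ^+ 2 * rho * (sigma ^+ 2 * m%:R).
    by rewrite ltr_pM2r// mulr_gt0.
  lra.
- by move: obj; rewrite /y bz mulmx0 add0r.
Qed.

End lasso_good.

(** * The second subsample and the random split *)

(** Conditioning on the first component: sections over [Bad] are bounded by 1, the others by [c]. *)
Lemma product_section_le d1 d2 (T1 : measurableType d1) (T2 : measurableType d2)
    (R : realType) (P1 : probability T1 R) (P2 : probability T2 R)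
    (W : set (T1 * T2)) (Bad : set T1) (a c : R) :
  measurable W -> measurable Bad -> (P1 Bad <= a%:E)%E -> 0 <= c ->
  (forall x, ~ Bad x -> (P2 [set y | W (x, y)] <= c%:E)%E) ->
  ((P1 \x P2) W <= (a + c)%:E)%E.
Proof.
move=> mW mBad Pa c0 Pc.
have mx : measurable_fun setT (fun x => P2 (xsection W x)).
  exact: measurable_fun_xsection.
apply: (@le_trans _ _ (\int[P1]_x ((\1_Bad x)%:E + c%:E))%E).
  rewrite /product_measure1; apply: ge0_le_integral => //.
  - apply: emeasurable_funD => //.
    exact/measurable_EFinP/measurable_indic.
  - move=> x _ /=; rewrite indicE; have [xB|xB] := boolP (x \in Bad).
      by rewrite -EFinD (le_trans (probability_le1 _ _))// ?lee_fin ?lerDl//;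
        exact: measurable_xsection.
    rewrite add0e; have -> : xsection W x = [set y | W (x, y)].
      by apply/seteqP; split => y; rewrite /xsection /= inE.
    by apply: Pc; move: xB; rewrite notin_setE.
rewrite ge0_integralD//.
- rewrite integral_indic// setIT integral_cst//= probability_setT mule1.
  by rewrite EFinD leeD.
- exact/measurable_EFinP/measurable_indic.
Qed.

Lemma max0_dist (R : realDomainType) (x y : R) : 0 <= y -> `|Num.max x 0 - y| <= `|x - y|.
Proof.
move=> y0; have [x0|x0] := leP x 0 => //.
rewrite sub0r normrN ger0_norm// ler0_norm; lra.
Qed.

Section deviation.
Context (R : realType) (m m' p : nat) (sigma : R) (beta : 'cV[R]_p).
Variable bhat : {mfun ('M[R]_(m, p) * 'cV[R]_m)%type >-> 'cV[R]_p}.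

Definition first_fit (U : 'M[R]_(m, p + 1)) : 'cV[R]_p :=
  bhat (lsubmx U, lsubmx U *m beta + sigma *: rsubmx U).

Definition loss_error (b : 'cV[R]_p) (V : 'M[R]_(m', p + 1)) : R :=
  `|Num.max (m'%:R^-1 * sqnorm2 (lsubmx V *m beta + sigma *: rsubmx V
                                 - lsubmx V *m b) - sigma ^+ 2) 0
    - norm2 (b - beta) ^+ 2|.

Lemma measurable_first_fit : measurable_fun setT first_fit.
Proof.
have mfit : measurable_fun setT (fun U : 'M[R]_(m, p + 1) =>
    (lsubmx U, lsubmx U *m beta + sigma *: rsubmx U)).
  apply: measurable_fun_pair; apply: measurable_fun_mx => i j.
    by under eq_fun do rewrite mxE; exact: measurable_mx_entry.
  under eq_fun do rewrite mxE; apply: measurable_funD.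
    apply: measurable_fun_mulmx => // k l.
    by under eq_fun do rewrite mxE; exact: measurable_mx_entry.
  under eq_fun do rewrite !mxE; apply: measurable_funM => //.
  exact: measurable_mx_entry.
exact: (measurableT_comp (measurable_funP bhat) mfit).
Qed.

Lemma measurable_loss_error : measurable_fun setT
  (fun UV : 'M[R]_(m, p + 1) * 'M[R]_(m', p + 1) =>
     loss_error (first_fit UV.1) UV.2).
Proof.
have mb j : measurable_fun setT
    (fun UV : 'M[R]_(m, p + 1) * 'M[R]_(m', p + 1) => first_fit UV.1 j ord0).
  apply: (measurableT_comp (@measurable_mx_entry _ _ _ _ j ord0)).
  exact: (measurableT_comp measurable_first_fit measurable_fst).
have mV i j : measurable_fun setT
    (fun UV : 'M[R]_(m, p + 1) * 'M[R]_(m', p + 1) => UV.2 i j).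
  exact: (measurableT_comp (@measurable_mx_entry _ _ _ _ i j) measurable_snd).
apply: measurableT_comp => //; apply: measurable_funB.
  apply: measurable_maxr => //; apply: measurable_funB => //.
  apply: measurable_funM => //; apply: measurable_fun_sqnorm2 => i.
  under eq_fun do rewrite mxE [X in X + _]mxE [X in _ + X]mxE.
  apply: measurable_funB; first apply: measurable_funD.
  - apply: measurable_fun_mulmx => // k l.
    by under eq_fun do rewrite mxE; exact: mV.
  - under eq_fun do rewrite !mxE; apply: measurable_funM => //; exact: mV.
  - apply: measurable_fun_mulmx => k l.
      by under eq_fun do rewrite mxE; exact: mV.
    by rewrite ord1; exact: mb.
under eq_fun do rewrite sqr_norm2.
apply: measurable_fun_sqnorm2 => i; under eq_fun do rewrite !mxE.
exact: measurable_funB.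
Qed.

(** The vector on the right has squared norm |b - beta|^2 + sigma^2, so subtracting sigma^2 centers
    the estimator exactly at the loss. *)
Lemma residual_mul (b : 'cV[R]_p) (V : 'M[R]_(m', p + 1)) :
  lsubmx V *m beta + sigma *: rsubmx V - lsubmx V *m b =
  V *m col_mx (beta - b) sigma%:M.
Proof.
rewrite -{4}[V]hsubmxK mul_row_col mulmxBr mul_mx_scalar.
by rewrite addrAC.
Qed.

Lemma loss_error_prob (G1 : probability 'M[R]_(m, p + 1) R)
    (G2 : probability 'M[R]_(m', p + 1) R) (A eta x : R) (k : nat) :
  gaussian_entries G1 -> gaussian_entries G2 ->
  (0 < m)%N -> (16 <= m')%N -> (1 < p)%N -> 0 < sigma -> 0 < A -> 2 <= A ^+ 2 ->
  (norm0 beta <= k)%N -> k%:R * (ln p%:R / m%:R) <= sparsity_const R ->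
  (forall X y b, lasso_obj (lasso_lambda A sigma m p) X y (bhat (X, y)) <=
                 lasso_obj (lasso_lambda A sigma m p) X y b) ->
  0 <= x ->
  x * (lasso_radius sigma A (eig_const R) (col_const R) (sparsity_const R) + sigma ^+ 2)
    / Num.sqrt m'%:R <= eta ->
  ((G1 \x G2) [set UV | (eta <= loss_error (first_fit UV.1) UV.2)%R] <=
   (3 * expR (- (m%:R / 2)) + 2 * expR (4 - x))%:E)%E.
Proof.
move=> GG1 GG2 m0 m16 p1 s0 A0 A2 bk krho opt x0 xeta.
have [Bad [mBad PBad good]] := lasso_consistent GG1 m0 p1.
apply: (product_section_le _ mBad PBad).
- by apply: measurable_ler => //; exact: measurable_loss_error.
- by rewrite mulr_ge0// expR_ge0.
move=> U nBad /=.
have hM : sqnorm2 (first_fit U - beta) <=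
    lasso_radius sigma A (eig_const R) (col_const R) (sparsity_const R).
  by apply: (good U nBad sigma A beta _ k) => //; exact: opt.
(* Given [U] the estimator is a constant, of which only the error bound is kept. *)
move: (first_fit U) hM => b hM.
pose u : 'cV[R]_(p + 1) := col_mx (beta - b) sigma%:M.
have uE : sqnorm2 u = sqnorm2 (b - beta) + sigma ^+ 2.
  rewrite sqnorm2_col_mx -opprB -scaleN1r sqnorm2Z sqrrN expr1n mul1r.
  by congr (_ + _); rewrite /sqnorm2 big_ord1 mxE.
have u0 : 0 < sqnorm2 u by rewrite uE ltr_wpDl ?sqnorm2_ge0// exprn_gt0.
have m'R : 0 < m'%:R :> R by rewrite ltr0n (leq_trans _ m16).
apply: le_trans (gaussian_fluctuation (u := u) x GG2 u0 m16).
have mW : measurable_fun setT (fun V : 'M[R]_(m', p + 1) => sqnorm2 (V *m u)).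
  exact: measurable_sqnorm2_mul.
apply: le_measure; rewrite ?inE.
- have -> : [set V | eta <= loss_error b V] = [set V : 'M[R]_(m', p + 1) | eta <=
      `|Num.max (m'%:R^-1 * sqnorm2 (V *m u) - sigma ^+ 2) 0
        - norm2 (b - beta) ^+ 2|].
    by apply/seteqP; split => V; rewrite /loss_error /= residual_mul.
  apply: measurable_ler => //; apply: measurableT_comp => //.
  apply: measurable_funB => //; apply: measurable_maxr => //.
  by apply: measurable_funB => //; exact: measurable_funM.
- apply: measurable_ler => //; apply: measurableT_comp => //.
  by apply: measurable_funB => //; exact: measurable_funM.
- move=> V /= etaV; rewrite -mulrA mulrCA.
  apply: (@le_trans _ _ eta).
    apply: le_trans xeta; rewrite mulrCA mulrA ler_wpM2r ?invr_ge0 ?sqrtr_ge0//.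
    by rewrite ler_wpM2l// uE lerD2r.
  apply: (le_trans etaV); rewrite /loss_error residual_mul -/u.
  rewrite sqr_norm2; apply: le_trans (max0_dist _ (sqnorm2_ge0 _)) _.
  by rewrite uE mulrC -addrA -opprD [sigma ^+ 2 + _]addrC.
Qed.

End deviation.

(** * The model as a Gaussian matrix *)

(** (S + a I)(S - a I) = 0, and S + a I is positive definite, so each column of S - a I vanishes.
    This identifies the square root left existential in [gaussian_law]. *)
Lemma possemidef_sqrt_scalar (R : realType) p (S : 'M[R]_p) (a : R) :
  0 < a -> possemidef S -> S *m S = (a ^+ 2)%:M -> S = a%:M.
Proof.
move=> a0 [_ S0] SS.
apply/eqP; rewrite -subr_eq0; apply/eqP; set N := S - a%:M.
have SN : (S + a%:M) *m N = 0.
  rewrite /N mulmxBr !mulmxDl SS mul_mx_scalar mul_scalar_mx -scalar_mxM -expr2.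
  by rewrite [X in X - _]addrC subrr.
apply/matrixP => i j; rewrite [RHS]mxE.
pose v := col j N.
have Sv : (S + a%:M) *m v = 0 by rewrite /v colE mulmxA SN mul0mx.
have : (v^T *m S *m v) ord0 ord0 + a * sqnorm2 v = 0.
  have : (v^T *m ((S + a%:M) *m v)) ord0 ord0 = 0 by rewrite Sv mulmx0 mxE.
  by rewrite mulmxDl mulmxDr mxE mul_scalar_mx -scalemxAr mulmxA sqnorm2E
    [X in _ + X]mxE.
have := S0 v => Sv0 E.
have v0 : sqnorm2 v = 0.
  apply/le_anti; rewrite sqnorm2_ge0 andbT -(ler_pM2l a0) mulr0; lra.
have : v i ord0 ^+ 2 = 0.
  by apply: (psumr_eq0P _ v0) => // k _; rewrite sqr_ge0.
by move/eqP; rewrite sqrf_eq0 mxE => /eqP.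
Qed.

Lemma gaussian_law_scalar (R : realType) p (nu : set 'cV[R]_p -> \bar R) (a : R)
    (A : 'I_p -> set R) :
  0 < a -> gaussian_law nu 0 ((a ^+ 2)%:M) -> (forall j, measurable (A j)) ->
  (nu [set v | forall j, A j (v j ord0)] =
   \prod_(j < p) normal_prob (0 : R) 1 [set x | A j (a * x)%R])%E.
Proof.
move=> a0 [g [S [gstd S0 SS nuE]]] mA.
have SE := possemidef_sqrt_scalar a0 S0 SS.
have mA' : measurable [set v : 'cV[R]_p | forall j, A j (v j ord0)].
  apply: measurable_forall => j; rewrite -[X in measurable X]setTI.
  exact: (measurable_mx_entry _ _ measurableT (mA j)).
rewrite nuE// -gstd.
  congr (g _); apply/seteqP; split => v /= Av j;
    by have := Av j; rewrite SE add0r mul_scalar_mx mxE.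
move=> j; rewrite -[X in measurable X]setTI.
have : measurable_fun setT (fun x : R => a * x) by exact: measurable_funM.
by move=> /(_ measurableT _ (mA j)).
Qed.

Definition noise_mx (R : realType) n p (sigma : R) (beta : 'cV[R]_p)
    (Xy : 'M[R]_(n, p) * 'cV[R]_n) : 'M[R]_(n, p + 1) :=
  row_mx Xy.1 (sigma^-1 *: (Xy.2 - Xy.1 *m beta)).

Lemma measurable_noise_mx (R : realType) n p (sigma : R) (beta : 'cV[R]_p) :
  measurable_fun setT (@noise_mx R n p sigma beta).
Proof.
have mX i j : measurable_fun setT (fun Xy : 'M[R]_(n, p) * 'cV[R]_n => Xy.1 i j).
  exact: (measurableT_comp (@measurable_mx_entry _ _ _ _ i j) measurable_fst).
have my i j : measurable_fun setT (fun Xy : 'M[R]_(n, p) * 'cV[R]_n => Xy.2 i j).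
  exact: (measurableT_comp (@measurable_mx_entry _ _ _ _ i j) measurable_snd).
apply: measurable_fun_mx => i j; rewrite /noise_mx.
case: (split_ordP j) => k ->.
  by under eq_fun do rewrite row_mxEl; exact: mX.
under eq_fun do rewrite row_mxEr mxE mxE.
apply: measurable_funM => //; apply: measurable_funD; first exact: my.
under eq_fun do rewrite mxE; apply: measurableT_comp => //.
by apply: measurable_fun_mulmx => // *; exact: mX.
Qed.

Section model.
Context (R : realType) d (Om : measurableType d) (n p : nat).
Context (P : probability Om R) (X : {mfun Om >-> 'M[R]_(n, p)}).
Context (y : {mfun Om >-> 'cV[R]_n}) (theta : param R p).
Local Notation sigma := (psigma theta).
Local Notation beta := (pbeta theta).
Hypotheses (Sigma1 : pSigma theta = 1%:M) (s0 : 0 < sigma).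
Hypothesis model : linear_model P X y theta.

Let Z w := noise_mx sigma beta (X w, y w).

(** A box for [Z] is a design box intersected with a noise box; independence of noise and design,
    then of the rows, then of the coordinates factors its probability. *)
Lemma linear_model_boxes (B : 'I_n -> 'I_(p + 1) -> set R) :
  (forall i j, measurable (B i j)) ->
  (P [set w | mx_box B (Z w)] =
   \prod_(i < n) \prod_(j < p + 1) normal_prob (0 : R) 1 (B i j))%E.
Proof.
move=> mB; have [rows rowlaw epslaw indep] := model.
pose r : 'I_(p + 1) := rshift p ord0.
pose BX : set 'M[R]_(n, p) := mx_box (fun i j => B i (lshift 1 j)).
pose C i : set R := [set x | B i r (sigma^-1 * x)].
pose Be : set 'cV[R]_n := [set e | forall i, C i (e i ord0)].
have mC i : measurable (C i).
  rewrite -[X in measurable X]setTI.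
  have : measurable_fun setT (fun x : R => sigma^-1 * x).
    exact: measurable_funM.
  by move=> /(_ measurableT _ (mB i r)).
have mBX : measurable BX by exact: measurable_mx_box.
have mBe : measurable Be.
  apply: measurable_forall => i; rewrite -[X in measurable X]setTI.
  exact: (measurable_mx_entry _ _ measurableT (mC i)).
have -> : [set w | mx_box B (Z w)] =
    X @^-1` BX `&` (fun w => y w - X w *m beta) @^-1` Be.
  apply/seteqP; split => [w /= Bw|w /= [Xw ew] i j].
    split=> [i j|i]; first by have := Bw i (lshift 1 j); rewrite row_mxEl.
    by have := Bw i r; rewrite row_mxEr mxE.
  rewrite /Z /noise_mx; case: (split_ordP j) => k ->.
    by rewrite row_mxEl; exact: Xw.
  by rewrite ord1 row_mxEr mxE; exact: ew.
rewrite indep//.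
pose A i : set 'cV[R]_p := [set v | forall j, B i (lshift 1 j) (v j ord0)].
have mA i : measurable (A i).
  apply: measurable_forall => j; rewrite -[X in measurable X]setTI.
  exact: (measurable_mx_entry _ _ measurableT (mB i _)).
have -> : X @^-1` BX = [set w | forall i, A i (row i (X w))^T].
  apply/seteqP; split => w /= Xw i j; first by rewrite !mxE; exact: Xw.
  by have := Xw i j; rewrite !mxE.
rewrite rows//.
transitivity (\prod_(i < n) (\prod_(j < p) normal_prob (0 : R) 1 (B i (lshift 1 j))
   * normal_prob (0 : R) 1 (B i r)))%E; last first.
  by apply: eq_bigr => i _; rewrite big_split_ord big_ord1.
rewrite big_split /=; congr (_ * _)%E.
  apply: eq_bigr => i _.
  have := rowlaw i; have -> : pSigma theta = (1 ^+ 2)%:M by rewrite Sigma1 expr1n.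
  move=> /(gaussian_law_scalar ltr01).
  move=> /(_ _ (fun j => mB i (lshift 1 j))).
  rewrite /A => ->; apply: eq_bigr => j _; congr normal_prob.
  by apply/seteqP; split => x /=; rewrite mul1r.
rewrite (gaussian_law_scalar s0 epslaw mC); apply: eq_bigr => i _.
congr normal_prob; apply/seteqP; split => x; rewrite /C /= mulKf ?gt_eqF//.
Qed.

End model.

(** * Averaging over the random split *)

Lemma measure_fibers (R : realType) d (Om : measurableType d)
    (P : probability Om R) (I : finType) (S : Om -> I) (s : seq I) :
  (forall i, measurable [set w | S w = i]) -> uniq s ->
  measurable [set w | S w \in s] /\
  (P [set w | S w \in s] = \sum_(i <- s) P [set w | S w = i])%E.
Proof.
move=> mS; elim: s => [_|i s IH /= /andP[si us]].
  have -> : [set w | S w \in [::]] = set0 by apply/seteqP; split.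
  by rewrite big_nil measure0.
have [ms Ps] := IH us.
have -> : [set w | S w \in i :: s] = [set w | S w = i] `|` [set w | S w \in s].
  apply/seteqP; split => w /=; rewrite inE.
    by move=> /orP[/eqP|]; [left|right].
  by move=> [->|->]; rewrite ?eqxx ?orbT.
split; first exact: measurableU.
rewrite measureU//.
  by rewrite big_cons; congr (_ + _)%E; exact: Ps.
by apply/seteqP; split => // w /= [->]; rewrite (negbTE si).
Qed.

(** Split and data being independent, each fiber [S = I] contributes its weight times a probability
    about the data alone, so a bound valid for every fixed [I] survives averaging. *)
Lemma random_split_le (R : realType) d (Om : measurableType d) n p
    (P : probability Om R) (X : {mfun Om >-> 'M[R]_(n, p)})
    (y : {mfun Om >-> 'cV[R]_n}) (n1 : nat) (S : Om -> {set 'I_n})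
    (A : {set 'I_n} -> set ('M[R]_(n, p) * 'cV[R]_n)) (c : R) :
  (n1 <= n)%N -> random_split P X y n1 S ->
  (forall I, measurable (A I)) ->
  (forall I : {set 'I_n}, #|I| = n1 -> (P [set w | A I (X w, y w)] <= c%:E)%E) ->
  (P [set w | A (S w) (X w, y w)] <= c%:E)%E.
Proof.
move=> n1n [mS unif] mA PA.
pose s := enum [set I : {set 'I_n} | #|I| == n1]%SET.
have memS w : (S w \in s) = (#|S w| == n1) by rewrite mem_enum inE.
have C0 : 0 < 'C(n, n1)%:R :> R by rewrite ltr0n bin_gt0.
have cards : #|[set I : {set 'I_n} | #|I| == n1]%SET| = 'C(n, n1).
  by rewrite card_draws card_ord.
have mXy : measurable_fun setT (fun w => (X w, y w)).
  by apply: measurable_fun_pair; exact: measurable_funP.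
have mAI I : measurable [set w | A I (X w, y w)].
  by rewrite -[X in measurable X]setTI; exact: (mXy measurableT _ (mA I)).
have [ms Ps] := measure_fibers P mS (enum_uniq [set I : {set 'I_n} | #|I| == n1]%SET).
(* The uniform weights on the sets of size [n1] sum to 1, so other sizes have probability 0. *)
have P1 : (P [set w | S w \in s] = 1)%E.
  rewrite Ps big_enum /=.
  transitivity (\sum_(I in [set I : {set 'I_n} | #|I| == n1]%SET)
    ('C(n, n1)%:R^-1)%:E : \bar R)%E.
    apply: eq_bigr => I; rewrite inE => /eqP cI.
    have := unif I cI setT measurableT.
    have -> : [set w | S w = I /\ setT (X w, y w)] = [set w | S w = I].
      by apply/seteqP; split => w /=; [case|].
    have -> : [set w | setT (X w, y w)] = [set: Om] by apply/seteqP; split.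
    by rewrite probability_setT mule1.
  by rewrite sumEFin sumr_const cards -[_^-1 *+ _]mulr_natr mulVf ?gt_eqF.
have mSA I : measurable [set w | S w = I /\ A I (X w, y w)].
  by have := measurableI _ _ (mS I) (mAI I).
pose B (I : {set 'I_n}) := if #|I| == n1 then [set w | S w = I /\ A I (X w, y w)] else set0.
have mB I : measurable (B I).
  by rewrite /B; case: ifP.
have mU : measurable [set w | exists I, B I w] by exact: measurable_exists.
have mE : measurable [set w | A (S w) (X w, y w)].
  have -> : [set w | A (S w) (X w, y w)] =
      [set w | exists I, S w = I /\ A I (X w, y w)].
    by apply/seteqP; split => w /=; [exists (S w)|move=> [I [->]]].
  exact: measurable_exists.
apply: (@le_trans _ _ (P ([set w | exists I, B I w] `|` ~` [set w | S w \in s]))).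
  apply: le_measure; rewrite ?inE//.
    by apply: measurableU => //; exact: measurableC.
  move=> w /= Aw; have [Sw|Sw] := boolP (S w \in s); last by right; apply/negP.
  by left; exists (S w); rewrite /B -memS Sw.
apply: (le_trans (measureU2 _ mU (measurableC ms))).
rewrite /= probability_setC// P1 subee// adde0.
apply: (le_trans (measure_exists_sum _ mB)).
apply: (@le_trans _ _ (\sum_(I in [set I : {set 'I_n} | #|I| == n1]%SET)
    ('C(n, n1)%:R^-1 * c)%:E)%E).
  rewrite [leRHS]big_mkcond /=; apply: lee_sum => I _; rewrite /B inE.
  case: eqP => [cI|_]; last by rewrite measure0.
  by rewrite unif// EFinM lee_wpmul2l// ?PA// lee_fin invr_ge0 ltW.
by rewrite sumEFin sumr_const cards -[(_ * _) *+ _]mulr_natr mulrAC mulVf ?gt_eqF// mul1r.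
Qed.

Lemma deviation_probability (R : realType) d (Om : measurableType d) n p
    (P : probability Om R) (X : {mfun Om >-> 'M[R]_(n, p)})
    (y : {mfun Om >-> 'cV[R]_n}) (n1 n2 : nat) (S : Om -> {set 'I_n})
    (theta : param R p) (A eta x : R) (k : nat)
    (bhat : forall m p,
       {mfun ('M[R]_(m, p) * 'cV[R]_m)%type >-> 'cV[R]_p})
    (betaL : Om -> 'cV[R]_p) :
  (forall w, betaL w =
     bhat _ _ (subsample (S w) (X w), subsample (S w) (y w))) ->
  let sigma := psigma theta in let beta := pbeta theta in
  pSigma theta = 1%:M -> 0 < sigma -> 0 < A -> 2 <= A ^+ 2 ->
  linear_model P X y theta -> random_split P X y n1 S ->
  (n1 + n2 = n)%N -> (0 < n1)%N -> (16 <= n2)%N -> (1 < p)%N ->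
  (norm0 beta <= k)%N -> k%:R * (ln p%:R / n1%:R) <= sparsity_const R ->
  is_lasso A sigma bhat -> 0 <= x ->
  x * (lasso_radius sigma A (eig_const R) (col_const R) (sparsity_const R) + sigma ^+ 2)
    / Num.sqrt n2%:R <= eta ->
  (P [set w | (eta <= `|Ltilde2 sigma (S w) (X w) (y w) (betaL w)
                        - norm2 (betaL w - beta) ^+ 2|)%R] <=
   (3 * expR (- (n1%:R / 2)) + 2 * expR (4 - x))%:E)%E.
Proof.
move=> betaLE sigma beta Sigma1 s0 A0 A2 model hsplit n12 n10 n216 p1 bk krho opt x0 xeta.
pose Z Xy := @noise_mx R n p sigma beta Xy.
pose W (I : {set 'I_n}) : set ('M[R]_(#|I|, p + 1) * 'M[R]_(#|~: I|, p + 1)) :=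
  [set UV | eta <= loss_error sigma beta (first_fit sigma beta (bhat _ _) UV.1) UV.2].
have mW I : measurable (W I).
  by apply: measurable_ler => //; exact: measurable_loss_error.
pose psi (I : {set 'I_n}) Xy := (subsample I (Z Xy), subsample (~: I) (Z Xy)).
have mpsi I : measurable_fun setT (psi I).
  apply: measurable_fun_pair; apply: measurable_fun_mx => i j;
    under eq_fun do rewrite mxE;
    exact: (measurableT_comp (@measurable_mx_entry _ _ _ _ _ j)
      (@measurable_noise_mx R n p sigma beta)).
(* For fixed [I] the error depends on the data only through the two blocks of the standardized
   matrix [Z]. *)
have key (I : {set 'I_n}) (Xy : 'M[R]_(n, p) * 'cV[R]_n) :
    let b := bhat _ _ (subsample I Xy.1, subsample I Xy.2) in
    `|Ltilde2 sigma I Xy.1 Xy.2 b - norm2 (b - beta) ^+ 2| =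
    loss_error sigma beta (first_fit sigma beta (bhat _ _) (psi I Xy).1) (psi I Xy).2.
  have lZ (J : {set 'I_n}) : lsubmx (subsample J (Z Xy)) = subsample J Xy.1.
    by apply/matrixP => i j; rewrite 2!mxE row_mxEl mxE.
  have rZ (J : {set 'I_n}) : subsample J Xy.1 *m beta +
      sigma *: rsubmx (subsample J (Z Xy)) = subsample J Xy.2.
    apply/matrixP => i j; rewrite ord1 mxE [X in _ + X]mxE.
    rewrite 2![X in _ * X]mxE row_mxEr [X in _ * X]mxE mulVKf ?gt_eqF//.
    have -> : (subsample J Xy.1 *m beta) i 0 = (Xy.1 *m beta) (enum_val i) 0.
      by rewrite !mxE; apply: eq_bigr => l _; rewrite mxE.
    by rewrite [X in _ + X]mxE [X in _ + (_ + X)]mxE addrCA subrr addr0 mxE.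
  by rewrite /loss_error /first_fit /psi /= !lZ !rZ.
have -> : [set w | eta <= `|Ltilde2 sigma (S w) (X w) (y w) (betaL w)
    - norm2 (betaL w - beta) ^+ 2|] =
    [set w | (psi (S w) @^-1` W (S w)) (X w, y w)].
  by apply/seteqP; split => w; rewrite /W /= -key betaLE.
apply: (random_split_le (A := fun I => psi I @^-1` W I) _ hsplit).
- by rewrite -n12 leq_addr.
- by move=> I; rewrite -[X in measurable X]setTI; exact: (mpsi I measurableT _ (mW I)).
move=> I cI.
have cIc : #|~: I| = n2.
  by apply/eqP; rewrite -(eqn_add2l #|I|) cardsC card_ord cI n12.
have [G1 GG1] := gaussian_mx R #|I| (p + 1).
have [G2 GG2] := gaussian_mx R #|~: I| (p + 1).
have -> : [set w | (psi I @^-1` W I) (X w, y w)] =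
    [set w | W I (subsample I (Z (X w, y w)), subsample (~: I) (Z (X w, y w)))].
  by [].
rewrite (gaussian_split _ (linear_model_boxes Sigma1 s0 model) GG1 GG2 (mW I)).
  rewrite -cI; apply: (loss_error_prob (k := k) GG1 GG2 _ _ p1 s0 A0 A2 bk) => //.
  - by rewrite cI.
  - by rewrite cIc.
  - by rewrite cI.
  - by rewrite cIc.
have mXy : measurable_fun setT (fun w => (X w, y w)).
  by apply: measurable_fun_pair; exact: measurable_funP.
exact: (measurableT_comp (@measurable_noise_mx R n p sigma beta) mXy).
Qed.

(** * Passage to the limit *)

Lemma limf_esup_eq0 (R : realType) (T : choiceType) (X : filteredType T)
    (f : X -> \bar R) (F : set_system X) :
  ~ F set0 -> (forall x, 0 <= f x)%E ->
  (forall eps : R, 0 < eps ->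
     exists2 V, F V & forall x, V x -> (f x <= eps%:E)%E) ->
  limf_esup f F = 0%E.
Proof.
move=> F0 f0 feps; apply/le_anti; rewrite limf_esup_ge0// andbT.
apply/lee_addgt0Pr => eps eps0; rewrite add0e.
have [V FV fV] := feps _ eps0.
rewrite limf_esupE; apply: (@le_trans _ _ (ereal_sup (f @` V))).
  by apply: ereal_inf_lbound; exists V.
by apply: ub_ereal_sup => _ [x Vx <-]; exact: fV.
Qed.

Lemma posdef1 (R : realType) p : posdef (1%:M : 'M[R]_p).
Proof.
split=> [|u u0]; first exact: trmx1.
rewrite mulmx1 -sqnorm2E lt_neqAle sqnorm2_ge0 andbT eq_sym.
apply: contra u0 => /eqP su; apply/eqP/colP => i; rewrite [RHS]mxE.
apply/eqP; rewrite -sqrf_eq0; apply/eqP.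
by apply: (psumr_eq0P _ su) => // j _; rewrite sqr_ge0.
Qed.

Theorem proposition1 (R : realType) (K : R) (hK : 0 < K) :
  exists2 c : R, 0 < c &
  forall (sigma0 A : R), 0 < sigma0 -> Num.sqrt 2 < A ->
  forall (k n1 n2 : nat -> nat -> nat),
    (forall n p, (1 < n)%N -> (1 < p)%N ->
       (k n p)%:R <= c * (n%:R / ln p%:R)) ->
    (forall n p, (n1 n p + n2 n p)%N = n) ->
    (forall n p, (1 < n)%N -> (1 < p)%N ->
       (n1 n p)%:R <= K * (n2 n p)%:R /\ (n2 n p)%:R <= K * (n1 n p)%:R) ->
  forall (d : nat -> nat -> measure_display)
    (Om : forall n p, measurableType (d n p))
    (P : forall n p, param R p -> probability (Om n p) R)
    (X : forall n p, {mfun Om n p >-> 'M[R]_(n, p)})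
    (y : forall n p, {mfun Om n p >-> 'cV[R]_n})
    (S : forall n p, Om n p -> {set 'I_n}),
    (forall n p (theta : param R p), admissible theta ->
       linear_model (P n p theta) (X n p) (y n p) theta /\
       random_split (P n p theta) (X n p) (y n p) (n1 n p) (S n p)) ->
  forall bhat : forall m p,
      {mfun ('M[R]_(m, p) * 'cV[R]_m)%type >-> 'cV[R]_p},
    is_lasso A sigma0 bhat ->
  forall delta : nat -> nat -> R,
    delta np.1 np.2 @[np --> filter_prod \oo \oo] --> +oo ->
  let betaL n p (w : Om n p) : 'cV[R]_p :=
    bhat _ _ (subsample (S n p w) (X n p w), subsample (S n p w) (y n p w)) in
  let L2 n p (w : Om n p) : R :=
    Ltilde2 sigma0 (S n p w) (X n p w) (y n p w) (betaL n p w) in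
  limf_esup
    (fun np : nat * nat => ereal_sup
       [set P np.1 np.2 theta
          [set w | delta np.1 np.2 * (1 / Num.sqrt np.1%:R) <=
                   `|L2 np.1 np.2 w
                     - norm2 (betaL np.1 np.2 w - pbeta theta) ^+ 2|]
       | theta in Theta0 sigma0 (k np.1 np.2)])
    (filter_prod \oo \oo) = 0%E.
Proof.
have K1 : 0 < 1 + K by rewrite addr_gt0.
have c00 : 0 < sparsity_const R.
  by rewrite /sparsity_const divr_gt0 ?mulr_gt0 ?exprn_gt0 ?eig_const_gt0// /col_const.
(* Balance gives n <= (1 + K) n1, so k log p / n1 stays below [sparsity_const]. *)
exists (sparsity_const R / (1 + K)); first exact: divr_gt0.
move=> sigma A s0 A2 k n1 n2 hk hn hbal d Om P X y S model bhat opt delta hdelta betaL L2.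
have sq2 : 0 < Num.sqrt 2 :> R by rewrite sqrtr_gt0.
have A0 : 0 < A by exact: lt_trans A2.
have A22 : 2 <= A ^+ 2.
  rewrite -[leLHS](@sqr_sqrtr _ 2)// ltW// ltrXn2r// ?nnegrE ?(ltW sq2) ?(ltW A0)//.
pose M := lasso_radius sigma A (eig_const R) (col_const R) (sparsity_const R) + sigma ^+ 2.
have M0 : 0 < M.
  rewrite ltr_wpDl ?exprn_gt0//.
  exact: lasso_radius_ge0.
apply: limf_esup_eq0.
- exact: filter_not_empty.
- move=> [n p] /=.
  (* A member of [Theta0] keeps the supremum from being that of the empty set, -oo. *)
  have th0 : Theta0 sigma (k n p) (Param (0 : 'cV[R]_p) 1%:M sigma).
    split => //=; rewrite /norm0 eq_card0// => j.
    by rewrite !inE mxE eqxx.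
  by apply: le_trans (ereal_sup_ubound (imageP _ th0)).
move=> eps eps0.
(* Subsamples of size at least [T1] give n2 >= 16 and 3 exp(-n1/2) <= eps/2; x >= [B0] gives 2 exp(4
   - x) <= eps/2. The choice x = delta / g turns the scale M / sqrt n2 into 1 / sqrt n, as n <= (1 +
   K) n2. *)
pose T1 : R := Num.max 16 (- 2 * ln (eps / 6)).
pose B0 : R := Num.max 0 (4 - ln (eps / 4)).
pose g : R := Num.sqrt (1 + K) * M.
have g0 : 0 < g by rewrite mulr_gt0// sqrtr_gt0.
pose N := (Num.bound ((1 + K) * T1)).+2.
have deltaB : \forall np \near filter_prod \oo \oo, g * B0 <= delta np.1 np.2.
  by move/cvgryPge: hdelta => /(_ (g * B0)).
have big : filter_prod \oo \oo [set np : nat * nat | (N <= np.1)%N /\ (1 < np.2)%N].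
  exists ([set n | (N <= n)%N], [set p | (1 < p)%N]) => //=.
  by split; [exists N|exists 2%N].
exists ([set np | g * B0 <= delta np.1 np.2] `&`
        [set np | (N <= np.1)%N /\ (1 < np.2)%N]).
  exact: filterI.
move=> [n p] [/= dB [Nn p1]].
apply: ub_ereal_sup => _ [theta [bk Sigma1 sig] <-].
have n1' : (1 < n)%N by apply: leq_trans Nn.
have [hK1 hK2] := hbal n p n1' p1.
have nR : (n1 n p)%:R + (n2 n p)%:R = n%:R :> R by rewrite -natrD hn.
have nT : (1 + K) * T1 <= n%:R.
  have T10 : 0 <= T1 by rewrite le_max ler0n.
  have := archi_boundP (mulr_ge0 (ltW K1) T10).
  move=> /ltW/le_trans; apply; rewrite ler_nat.
  by apply: leq_trans Nn; rewrite /N -addn2 leq_addr.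
have n1T : T1 <= (n1 n p)%:R by rewrite -(ler_pM2l K1); lra.
have n2T : T1 <= (n2 n p)%:R by rewrite -(ler_pM2l K1); lra.
have T16 : 16 <= T1 by rewrite /T1 le_max lexx.
have n10 : (0 < n1 n p)%N by rewrite -(ltr0n R); lra.
have n216 : (16 <= n2 n p)%N by rewrite -(ler_nat R); lra.
have adm : admissible theta by split; [rewrite Sigma1; exact: posdef1|rewrite sig].
have [lm rs] := model n p theta adm.
have n1R : 0 < (n1 n p)%:R :> R by rewrite ltr0n.
have lnp : 0 < ln p%:R :> R by rewrite ln_gt0// ltr1n.
have krho : (k n p)%:R * (ln p%:R / (n1 n p)%:R) <= sparsity_const R.
  have := ler_wpM2r (ltW lnp) (hk n p n1' p1).
  rewrite -[sparsity_const R / _ * _ * _]mulrA divfK ?gt_eqF// => H.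
  rewrite mulrA ler_pdivrMr//; apply: (le_trans H).
  have -> : sparsity_const R * (n1 n p)%:R = sparsity_const R / (1 + K) * ((1 + K) * (n1 n p)%:R).
    by field; rewrite gt_eqF.
  by rewrite ler_wpM2l ?(divr_ge0 (ltW c00) (ltW K1))//; lra.
pose x := delta n p / g.
have xB : B0 <= x by rewrite /x ler_pdivlMr// mulrC.
have x0 : 0 <= x by apply: le_trans xB; rewrite /B0 le_max lexx.
have xeta : x * M / Num.sqrt (n2 n p)%:R <= delta n p * (1 / Num.sqrt n%:R).
  have d0 : 0 <= delta n p by apply: le_trans dB; rewrite mulr_ge0 ?(ltW g0)// le_max lexx.
  have sK : 0 < Num.sqrt (1 + K) by rewrite sqrtr_gt0.
  have n2R : 0 < (n2 n p)%:R :> R by lra.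
  have sn2 : 0 < Num.sqrt (n2 n p)%:R :> R by rewrite sqrtr_gt0.
  have -> : x * M / Num.sqrt (n2 n p)%:R =
      delta n p * (Num.sqrt (1 + K) * Num.sqrt (n2 n p)%:R)^-1.
    by rewrite /x /g; field; rewrite !gt_eqF.
  rewrite div1r ler_wpM2l// lef_pV2 ?posrE ?mulr_gt0// ?sqrtr_gt0 ?ltr0n ?(ltn_trans _ n1')//.
  by rewrite -sqrtrM ?(ltW K1)// ler_wsqrtr//; lra.
have s0' : 0 < psigma theta by rewrite sig.
have opt' : is_lasso A (psigma theta) bhat by rewrite sig.
have xeta' : x *
    (lasso_radius (psigma theta) A (eig_const R) (col_const R) (sparsity_const R)
     + psigma theta ^+ 2) / Num.sqrt (n2 n p)%:R <= delta n p * (1 / Num.sqrt n%:R).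
  by rewrite sig.
have H := @deviation_probability R _ _ n p (P n p theta) (X n p) (y n p)
  (n1 n p) (n2 n p) (S n p) theta A (delta n p * (1 / Num.sqrt n%:R)) x (k n p)
  bhat (betaL n p) (fun w => erefl) Sigma1 s0' A0 A22 lm rs (hn n p) n10 n216
  p1 bk krho opt' x0 xeta'.
rewrite sig in H.
apply: (le_trans H).
rewrite lee_fin.
have e1 : expR (- ((n1 n p)%:R / 2)) <= eps / 6.
  rewrite -[leRHS]lnK ?posrE ?divr_gt0// ler_expR.
  have : - 2 * ln (eps / 6) <= T1 by rewrite /T1 le_max lexx orbT.
  lra.
have e2 : expR (4 - x) <= eps / 4.
  rewrite -[leRHS]lnK ?posrE ?divr_gt0// ler_expR.
  have : 4 - ln (eps / 4) <= B0 by rewrite /B0 le_max lexx orbT.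
  lra.
lra.
Qed.
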